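(* Let $\theta^{SC(l)}=A_{\rho^{(l)}}^{-1}\theta^{(l)}\in\Theta$ be posterior samples under a model with spectral clustering and let $\tilde\theta\in\widetilde\Theta$, where $\widetilde\Theta=\{\tilde\theta\in\Theta: W\tilde\theta=p\}$ (all objects defined in the context). Then: (i) The problem of minimizing the convex differentiable objective $$\rho^{(l)}(\vartheta-\theta^{(l)})^{\top}(\vartheta-\theta^{(l)})+(1-\rho^{(l)})\,\vartheta^{\top}L_{SC}\,\vartheta\quad\text{over }\vartheta\text{ subject to }W\vartheta=p$$ is a projection problem: it is equivalent to $$\underset{\tilde\theta}{\text{minimize}}\;\left\{\|\theta^{SC(l)}-\tilde\theta\|_{A_{\rho^{(l)}}^{-1}}:\ \tilde\theta\in\widetilde\Theta\right\},$$ where $\tilde\theta$ is the projection of $\theta^{SC(l)}$ via the weighted inner product defined by $A_{\rho^{(l)}}^{-1}$. (ii) When the model in (i) is the FH-SC model (samples then written $\theta^{FHSC(l)}$), the solution of the minimization problem over $\widetilde\Theta$ in (i) is given by the projected samples $$\theta^{FHSC\text{-}B(l)}=\theta^{FHSC(l)}+A_{\rho^{(l)}}^{-1}W^{\top}(WA_{\rho^{(l)}}^{-1}W^{\top})^{-1}\left(p-W\theta^{FHSC(l)}\right),$$ where $l=1,\dots,L$ indexes the posterior samples under the FH-SC model. (iii) The conditional expectation of the small area benchmarked parameter vector for the $l$-th posterior sample is $$E(\theta^{FHSC\text{-}B(l)}\mid X,Z,y,\vartheta^{(l)})=E(\theta^{FHSC(l)}\mid X,Z,y,\vartheta^{(l)})+A_{\rho^{(l)}}^{-1}W^{\top}(WA_{\rho^{(l)}}^{-1}W^{\top})^{-1}\left(p-W\,E(\theta^{FHSC(l)}\mid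 X,Z,y,\vartheta^{(l)})\right),$$ where $\vartheta^{(l)}=(\delta^{(l-1)},G_{\varphi^{(l-1)}},\rho^{(l)})$ and $E(\theta^{FHSC(l)}\mid X,Z,y,\vartheta^{(l)})$ is the conditional posterior expectation whose cluster-$c$ block is given in the context. When the benchmarking constraints are given by $\sum_{c=1}^{C}\sum_{j=1}^{n_c}w_{j,c}\theta_{j,c}^{FHSC(l)}=p$, the conditional expectation of the small area benchmarked parameter vector under the FH-SC model for cluster $c$, $c=1,\dots,C$, is $$E(\theta_c^{FHSC\text{-}B(l)}\mid X_c,Z_c,y_c,\vartheta_c^{(l)})=E(\theta_c^{FHSC(l)}\mid X_c,Z_c,y_c,\vartheta_c^{(l)})+a_{\rho^{(l)},c}\left(p-w_c\,E(\theta_c^{FHSC(l)}\mid X_c,Z_c,y_c,\vartheta_c^{(l)})\right),$$ where $\vartheta_c^{(l)}=(\delta_c^{(l-1)},G_{\varphi^{(l-1)},c},\rho^{(l)})$, $w_c=(w_{1,c},\dots,w_{n_c,c})$ denotes the benchmarking weights for cluster $c$ (a row vector), and $$a_{\rho^{(l)},c}=\frac{\gamma_c^{(l)}w_c^{\top}+(1-\gamma_c^{(l)})\bar w_c\mathbf 1_{n_c}}{\gamma_c^{(l)}\sum_{j=1}^{n_c}w_{j,c}^{2}+(1-\gamma_c^{(l)})n_c\bar w_c^{2}},\qquad \bar w_c=\frac1{n_c}\sum_{j=1}^{n_c}w_{j,c},\qquad \gamma_c^{(l)}=\frac{\rho^{(l)}}{(1-\rho^{(l)})n_c+\rho^{(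l)}}.$$
   Context: $\mathbb I_k$ is the $k\times k$ identity and $\mathbf 1_k$ the column vector of $k$ ones. The $m$ small areas are split into $C$ clusters of sizes $n_1,\dots,n_C$; $L_{SC}=\mathrm{blkdiag}(L_1,\dots,L_C)$ with $L_c=n_c\mathbb I_{n_c}-\mathbf 1_{n_c}\mathbf 1_{n_c}^{\top}$. $W\in\mathbb R^{k\times m}$ has full row rank $k\le m$, and $p\in\mathbb R^k$ is the vector of benchmarks. $\Theta$ is the parameter space of the small area parameter vector. For $l=1,\dots,L$, $(\theta^{(l)},\rho^{(l)})$, with $\rho^{(l)}\in(0,1]$, are posterior samples, $A_{\rho}=\mathbb I_m+\frac{1-\rho}{\rho}L_{SC}$ (symmetric positive definite), and $\theta^{SC(l)}=A_{\rho^{(l)}}^{-1}\theta^{(l)}$. $\|\cdot\|_{A_{\rho^{(l)}}^{-1}}$ denotes the norm of the weighted inner product defined by $A_{\rho^{(l)}}^{-1}$. Spectral clustering model (general): $y=\theta^{SC}+e$, $\theta^{SC}=A_\rho^{-1}\theta$, $\theta=\mu+Zu$, with $e,u$ independent with zero means and covariance matrices $D$, $G_\varphi$. FH-SC model: for cluster $c$, $y_c=\theta_c^{FHSC}+e_c$, $\theta_c^{FHSC}=A_{\rho,c}^{-1}\theta_c$, $\theta_c=X_c\delta_c+Z_cu_c$, with $e_c\sim N(0,D_c)$ and $u_c\sim N(0,G_{\varphi,c})$ independent, $D_c=\mathrm{diag}(D_{1,c},\dots,D_{n_c,c})$, $A_{\rho,c}=\mathbb I_{n_c}+\frac{1-\rho}{\rho}L_c$,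 so $A_\rho=\mathrm{blkdiag}(A_{\rho,1},\dots,A_{\rho,C})$; $X,Z,y,\delta,G_\varphi$ collect the cluster quantities, and $\theta_c^{FHSC(l)}$, $\theta_c^{FHSC\text{-}B(l)}$ are the cluster-$c$ sub-vectors of $\theta^{FHSC(l)}$, $\theta^{FHSC\text{-}B(l)}$. The conditional posterior expectation used in (iii): with ''$\mid\cdot$'' denoting conditioning on $(\delta_c,G_{\varphi,c},\rho,Z_c,X_c,y_c)$, evaluated at $(\delta_c^{(l-1)},G_{\varphi^{(l-1)},c},\rho^{(l)})$, and $\gamma_c=\rho/((1-\rho)n_c+\rho)$, $E(\theta_c^{FHSC}\mid\cdot)=\gamma_cE(\theta_c\mid\cdot)+(1-\gamma_c)\big(\frac1{n_c}\sum_{j}E(\theta_{j,c}\mid\cdot)\big)\mathbf 1_{n_c}$, where $E(\theta_c\mid\cdot)=V(\theta_c\mid\cdot)\big(D_c^{-1}A_{\rho,c}^{-1}y_c+(Z_cG_{\varphi,c}Z_c^{\top})^{-1}X_c\delta_c\big)$ and $V(\theta_c\mid\cdot)=\big((A_{\rho,c}D_cA_{\rho,c}^{\top})^{-1}+(Z_cG_{\varphi,c}Z_c^{\top})^{-1}\big)^{-1}$.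
   Formalization: The last formula is proved for one constraint per cluster (p_c); for the single constraint the sums over clusters replace its denominator and w_cE. E(θ_c|·) uses A⁻¹D⁻¹y, not D⁻¹A⁻¹y; the norm is sqrt(xᵀAx); (i), (ii) assume Θ contains all solutions of Wϑ = p. *)

(* Defs.v *)
From HB Require Import structures.
From mathcomp Require Import all_boot all_order all_algebra.
From mathcomp Require Import all_classical all_reals all_analysis.

Set Implicit Arguments.
Unset Strict Implicit.
Unset Printing Implicit Defensive.

Import Order.TTheory GRing.Theory Num.Theory.
Import numFieldNormedType.Exports.

Local Open Scope classical_set_scope.
Local Open Scope ring_scope.

Definition is_argmin (R : realType) (T : Type) (F : set T) (f : T -> R) (v : T)
    : Prop :=
  F v /\ forall v', F v' -> f v <= f v'.

(* The inner product defined by a symmetric positive definite matrix S follows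
   the covariance (Mahalanobis) convention <x, y>_S = x^T S^-1 y.  So the norm
   attached to S = A^-1 is x |-> sqrt (x^T A x).  With the opposite convention
   the constrained least-squares problem below would not be a projection and
   the minimizer would not be [benchmarked]. *)
Definition winner (R : realType) (m : nat) (S : 'M[R]_m) (x y : 'cV[R]_m) : R :=
  (x^T *m invmx S *m y) 0 0.

Definition wnorm (R : realType) (m : nat) (S : 'M[R]_m) (x : 'cV[R]_m) : R :=
  Num.sqrt (winner S x x).

(* Orthogonal projection of x on the affine subspace F. *)
Definition is_wproj (R : realType) (m : nat) (S : 'M[R]_m) (F : set 'cV[R]_m)
    (x z : 'cV[R]_m) : Prop :=
  F z /\ forall v, F v -> winner S (x - z) (v - z) = 0.

Definition benchmark_set (R : realType) (k m : nat) (W : 'M[R]_(k, m))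
    (p : 'cV[R]_k) : set 'cV[R]_m :=
  [set v | W *m v = p].

Definition benchmarked (R : realType) (k m : nat) (A : 'M[R]_m)
    (W : 'M[R]_(k, m)) (p : 'cV[R]_k) (x : 'cV[R]_m) : 'cV[R]_m :=
  x + invmx A *m W^T *m invmx (W *m invmx A *m W^T) *m (p - W *m x).

Definition ones (R : realType) (k : nat) : 'cV[R]_k := const_mx 1.
Arguments ones {R k}.

Definition L_cluster (R : realType) (k : nat) : 'M[R]_k :=
  k%:R *: 1%:M - ones *m ones^T.
Arguments L_cluster {R} k.

(* A vector indexed by the m small areas has type 'cV_(\sum_(c < C) n c); its
   cluster-c sub-vector is [submxcol _ c]. *)
Definition L_SC (R : realType) (C : nat) (n : 'I_C -> nat)
    : 'M[R]_(\sum_(c < C) n c) :=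
  \mxdiag_(c < C) L_cluster (n c).
Arguments L_SC {R C} n.

Definition A_SC (R : realType) (C : nat) (n : 'I_C -> nat) (rho : R)
    : 'M[R]_(\sum_(c < C) n c) :=
  1%:M + ((1 - rho) / rho) *: L_SC n.

Definition A_cluster (R : realType) (k : nat) (rho : R) : 'M[R]_k :=
  1%:M + ((1 - rho) / rho) *: L_cluster k.
Arguments A_cluster {R} k rho.

Definition SC_objective (R : realType) (C : nat) (n : 'I_C -> nat) (rho : R)
    (theta : 'cV[R]_(\sum_(c < C) n c)) (v : 'cV[R]_(\sum_(c < C) n c)) : R :=
  rho * ((v - theta)^T *m (v - theta)) 0 0
  + (1 - rho) * (v^T *m L_SC n *m v) 0 0.

(* The sigma-algebra on T generated by the random vector Y. *)
Definition sigma_vec d (T : measurableType d) (R : realType) (k : nat)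
    (Y : T -> 'cV[R]_k) : set (set T) :=
  g_sigma_preimage (fun (i : 'I_k) (t : T) => Y t i 0).

(* Mutual independence of a finite family of sigma-algebras.  Product rules for
   subfamilies are instances, with A i = setT for the omitted indices. *)
Definition mutually_independent d (T : measurableType d) (R : realType)
    (P : probability T R) (I : finType) (F : I -> set (set T)) : Prop :=
  forall A : I -> set T, (forall i, F i (A i)) ->
    P (\bigcap_(i in [set: I]) A i) = (\prod_(i : I) P (A i))%E.

(* u ~ N(mu, Sigma), Sigma symmetric positive semidefinite, possibly singular:
   u = mu + S xi, with xi a vector of rank(Sigma) i.i.d. standard normal
   variables and Sigma = S S^T.  S has full column rank, so that xi is a
   function of u. *)
Definition is_mvnormal d (T : measurableType d) (R : realType)
    (P : probability T R) (k : nat) (u : T -> 'cV[R]_k)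
    (mu : 'cV[R]_k) (Sigma : 'M[R]_k) : Prop :=
  exists (r : nat) (S : 'M[R]_(k, r)) (xi : 'I_r -> {RV P >-> R}),
    [/\ row_free S^T,
        S *m S^T = Sigma,
        (forall i (B : set R), measurable B ->
           distribution P (xi i) B = normal_prob 0 1 B),
        mutually_independent P (fun i => g_sigma_algebra_preimage (xi i)) &
        forall t, u t = mu + S *m \col_i xi i t].

(* h is (a version of) the conditional expectation E(X | F) of the random
   vector X given the sigma-algebra F. *)
Definition is_condexp d (T : measurableType d) (R : realType)
    (P : probability T R) (F : set (set T)) (k : nat) (X h : T -> 'cV[R]_k)
    : Prop :=
  forall i : 'I_k,
    [/\ P.-integrable setT (fun t => (X t i 0)%:E),
        P.-integrable setT (fun t => (h t i 0)%:E),
        (forall B : set R, measurable B -> F ((fun t => h t i 0) @^-1` B)) &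
        forall A, F A ->
          (\int[P]_(t in A) (X t i 0)%:E = \int[P]_(t in A) (h t i 0)%:E)%E].

(* FH-SC model, for fixed values of the parameters delta, G and rho. *)
Definition FHSC_errors d (T : measurableType d) (R : realType)
    (P : probability T R) (C : nat) (n q : 'I_C -> nat)
    (D : forall c, 'M[R]_(n c)) (G : forall c, 'M[R]_(q c))
    (e : forall c, T -> 'cV[R]_(n c)) (u : forall c, T -> 'cV[R]_(q c))
    : Prop :=
  [/\ forall c, is_mvnormal P (e c) 0 (D c),
      forall c, is_mvnormal P (u c) 0 (G c) &
      mutually_independent P (fun s : 'I_C + 'I_C =>
        match s with inl c => sigma_vec (e c) | inr c => sigma_vec (u c) end)].

Definition FHSC_theta (T : Type) (R : realType) (k s q : nat) (rho : R)
    (X : 'M[R]_(k, s)) (delta : 'cV[R]_s) (Z : 'M[R]_(k, q))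
    (u : T -> 'cV[R]_q) (t : T) : 'cV[R]_k :=
  invmx (A_cluster k rho) *m (X *m delta + Z *m u t).

Definition FHSC_y (T : Type) (R : realType) (k s q : nat) (rho : R)
    (X : 'M[R]_(k, s)) (delta : 'cV[R]_s) (Z : 'M[R]_(k, q))
    (u : T -> 'cV[R]_q) (e : T -> 'cV[R]_k) (t : T) : 'cV[R]_k :=
  FHSC_theta rho X delta Z u t + e t.

Definition gam (R : realType) (k : nat) (rho : R) : R :=
  rho / ((1 - rho) * k%:R + rho).
Arguments gam {R} k rho.

Definition avg (R : realType) (k : nat) (x : 'I_k -> R) : R :=
  k%:R^-1 * \sum_(j < k) x j.

(* Mean and variance of theta_c = X_c delta_c + Z_c u_c given y_c, for
   y_c = A^-1 theta_c + e_c.  As V(y_c | theta_c) = D and A is symmetric, y_c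
   enters the mean through A^-1 D^-1 y_c.  The factors must come in this order:
   D is diagonal but not scalar, hence does not commute with A. *)
Definition post_var (R : realType) (k q : nat) (rho : R) (D : 'M[R]_k)
    (Z : 'M[R]_(k, q)) (G : 'M[R]_q) : 'M[R]_k :=
  invmx (invmx (A_cluster k rho *m D *m (A_cluster k rho)^T)
         + invmx (Z *m G *m Z^T)).

Definition post_mean (R : realType) (k s q : nat) (rho : R) (D : 'M[R]_k)
    (X : 'M[R]_(k, s)) (delta : 'cV[R]_s) (Z : 'M[R]_(k, q)) (G : 'M[R]_q)
    (y : 'cV[R]_k) : 'cV[R]_k :=
  post_var rho D Z G *m
    (invmx (A_cluster k rho) *m invmx D *m y
     + invmx (Z *m G *m Z^T) *m (X *m delta)).

Definition post_mean_FHSC (R : realType) (k s q : nat) (rho : R) (D : 'M[R]_k)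
    (X : 'M[R]_(k, s)) (delta : 'cV[R]_s) (Z : 'M[R]_(k, q)) (G : 'M[R]_q)
    (y : 'cV[R]_k) : 'cV[R]_k :=
  let E := post_mean rho D X delta Z G y in
  gam k rho *: E + ((1 - gam k rho) * avg (fun j => E j 0)) *: ones.

(* One constraint per cluster: row c of W is w_c, in the columns of cluster c. *)
Definition cluster_W (R : realType) (C : nat) (n : 'I_C -> nat)
    (w : forall c, 'rV[R]_(n c)) : 'M[R]_(C, \sum_(c < C) n c) :=
  \matrix_(c < C) \mxrow_(c' < C) (w c' *+ (c' == c)).

(* a_{rho,c} = a_num / a_den. *)
Definition a_num (R : realType) (k : nat) (rho : R) (w : 'rV[R]_k) : 'cV[R]_k :=
  gam k rho *: w^T + ((1 - gam k rho) * avg (w 0)) *: ones.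

Definition a_den (R : realType) (k : nat) (rho : R) (w : 'rV[R]_k) : R :=
  gam k rho * (\sum_(j < k) w 0 j ^+ 2)
  + (1 - gam k rho) * k%:R * avg (w 0) ^+ 2.

(* Main.v *)
Require Import Defs.
From HB Require Import structures.
From mathcomp Require Import all_boot all_order all_algebra.
From mathcomp Require Import all_classical all_reals all_analysis.
From mathcomp Require Import measurable_realfun ring lra.

Set Implicit Arguments.
Unset Strict Implicit.
Unset Printing Implicit Defensive.

Import Order.TTheory GRing.Theory Num.Theory.
Import numFieldNormedType.Exports.

Local Open Scope classical_set_scope.
Local Open Scope ring_scope.

(** Since L_c^2 = n_c L_c, the matrix A_rho is positive definite, and completing the
    square turns the objective into rho times the squared A_rho-distance to
    A_rho^-1 theta plus a constant; (i) and (ii) are then the normal equations of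
    a projection on an affine subspace.

    For (iii), all errors are linear functions of one standard Gaussian vector xi.
    The difference between theta_c^FHSC and its claimed posterior mean is a linear
    form a.xi uncorrelated with the data y, so that every event A of sigma(y) is
    invariant under the shifts of xi by multiples of a.  The Cameron-Martin formula
    gives E(1_A exp(t a.xi)) = P(A) exp(t^2 |a|^2 / 2) for all real t, and since
    1 + x <= exp x this forces E(1_A a.xi) = 0.  The benchmarked vector is an affine
    function of theta^FHSC, and conditional expectations commute with affine maps. *)

(** * Densities and shifts of the normal law *)

(** Bayes' formula for densities is not the route to (iii): only [Z *m G *m Z^T] is assumed
    invertible, so [G] may be singular and [u] may have no density, while the claim concerns an
    abstract sigma-algebra. The defining property of a conditional expectation asks less than
    independence of residual and data: the residual must integrate to zero over every event of
    sigma(y). In the coordinates [xi], zero covariance becomes orthogonality of coefficient vectors,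
    so the probabilistic claim rests on one matrix identity per cluster, [resid_uncorrelated].

    Independence is assumed between the vectors [e c] and [u c], not between their standard normal
    coordinates. The full column rank in [is_mvnormal] bridges this gap: it makes the coordinates
    functions of the vectors.

    The weights [gam] and the vectors a_{rho,c} have one common source: on a cluster, A^-1 keeps the
    mean and contracts the deviations from it by [gam]. *)

Section density_measure.
Local Open Scope ereal_scope.
Context d (T : measurableType d) (R : realType).
Variables (mu : {measure set T -> \bar R}) (w : T -> R).
Hypotheses (mw : measurable_fun setT w) (w0 : forall x, (0 <= w x)%R).

(** The two proofs are arguments, so that the term itself carries what its measure structure
    requires. *)
Definition mdensity of measurable_fun setT w & (forall x, (0 <= w x)%R) :=
  fun A : set T => \int[mu]_(x in A) (w x)%:E.

Local Notation nu := (mdensity mw w0).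

Let mdensity0 : nu set0 = 0.
Proof. by rewrite /mdensity integral_set0. Qed.

Let mdensity_ge0 A : 0 <= nu A.
Proof. by apply: integral_ge0 => x _; rewrite lee_fin. Qed.

Let mdensity_sigma_additive : semi_sigma_additive nu.
Proof.
move=> F mF tF mUF; rewrite /mdensity ge0_integral_bigcup//.
- apply: is_cvg_ereal_nneg_natsum_cond => n _ _.
  by apply: integral_ge0 => x _; rewrite lee_fin.
- by apply/measurable_EFinP; exact: measurable_funTS.
- by move=> x _; rewrite lee_fin.
Qed.

HB.instance Definition _ := isMeasure.Build _ _ _ nu
  mdensity0 mdensity_ge0 mdensity_sigma_additive.

End density_measure.

Section ge0_integral_density.
Local Open Scope ereal_scope.
Context d (T : measurableType d) (R : realType).
Variables (mu nu : {measure set T -> \bar R}) (w : T -> R).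
Hypotheses (mw : measurable_fun setT w) (w0 : forall x, (0 <= w x)%R).
Hypothesis nuE : forall A, measurable A -> nu A = \int[mu]_(x in A) (w x)%:E.

Import HBNNSimple.

(** Stated for any [nu] with density [w], so that it covers the normal law over Lebesgue measure as
    well as [mdensity]. On indicators it is [nuE]; linearity and monotone convergence along
    [nnsfun_approx] do the rest. *)
Lemma ge0_integral_density (g : T -> \bar R) :
  measurable_fun setT g -> (forall x, 0 <= g x) ->
  \int[nu]_x g x = \int[mu]_x (g x * (w x)%:E).
Proof.
move=> mg g0.
have mwE : measurable_fun setT (EFin \o w) by exact/measurable_EFinP.
pose h := nnsfun_approx measurableT mg.
have hg x : (EFin \o h n) x @[n --> \oo] --> g x.
  by apply: cvg_nnsfun_approx => // y _; exact: g0.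
transitivity (limn (fun n => \int[nu]_x (h n x)%:E)).
  rewrite -monotone_convergence//.
  - by apply: eq_integral => x _; apply/esym/cvg_lim => //; exact: hg.
  - by move=> n; exact/measurable_EFinP.
  - by move=> n x _; rewrite lee_fin.
  - by move=> x _ a b ab; rewrite lee_fin; exact/lefP/nd_nnsfun_approx.
have -> : \int[mu]_x (g x * (w x)%:E) =
    limn (fun n => \int[mu]_x ((h n x)%:E * (w x)%:E)).
  rewrite -monotone_convergence//.
  - apply: eq_integral => x _; apply/esym/cvg_lim => //.
    by apply: cvgeZr => //; exact: hg.
  - by move=> n; apply/emeasurable_funM => //; exact/measurable_EFinP.
  - by move=> n x _; rewrite mule_ge0// lee_fin.
  - move=> x _ a b ab; rewrite lee_wpmul2r ?lee_fin//.
    exact/lefP/nd_nnsfun_approx.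
apply/congr_lim/funext => n.
transitivity (\int[nu]_x
   (\sum_(y \in range (h n)) (y * \1_(h n @^-1` [set y]) x)%:E)).
  by apply: eq_integral => t _; rewrite /= fimfunE -fsumEFin.
rewrite ge0_integral_fsum//; last 2 first.
  - move=> r; apply: (measurable_comp measurableT) => //.
    exact: measurable_funM.
  - by move=> m y _; exact: nnfun_muleindic_ge0.
transitivity (\int[mu]_x (\sum_(y \in range (h n))
    (y * \1_(h n @^-1` [set y]) x)%:E * (w x)%:E)); last first.
  apply: eq_integral => x _.
  rewrite -ge0_mule_fsuml => [|y]; last exact: nnfun_muleindic_ge0.
  by rewrite fsumEFin // -(fimfunE _ x).
rewrite ge0_integral_fsum//; last 2 first.
  - move=> y; apply: emeasurable_funM => //; apply/measurable_EFinP.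
    exact: measurable_funM.
  - move=> m y _; apply: mule_ge0; last by rewrite lee_fin.
    exact: nnfun_muleindic_ge0.
apply: eq_fsbigr => r rhn.
under [RHS]eq_integral do rewrite EFinM.
rewrite integralZl_indic_nnsfun => //.
under [RHS]eq_integral do rewrite -muleA.
rewrite ge0_integralZl//.
- congr (_ * _); rewrite integral_indic// setIT nuE//.
  under [RHS]eq_integral do rewrite muleC.
  rewrite [LHS]integral_mkcond; apply: eq_integral => x _.
  by rewrite epatch_indic.
- by apply: emeasurable_funM => //; exact/measurable_EFinP.
- by move=> t Et; rewrite mule_ge0 ?lee_fin.
- by move: rhn; rewrite inE => -[t _ <-]; rewrite lee_fin.
Qed.

Lemma ge0_integral_density_in (D : set T) (g : T -> \bar R) : measurable D ->
  measurable_fun setT g -> (forall x, 0 <= g x) ->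
  \int[nu]_(x in D) g x = \int[mu]_(x in D) (g x * (w x)%:E).
Proof.
move=> mD mg g0; rewrite integral_mkcond ge0_integral_density//; first last.
- by move=> x; exact: erestrict_ge0.
- exact: (measurable_restrictT _ _).1 (measurable_funTS _).
rewrite [RHS]integral_mkcond; apply: eq_integral => x _.
by rewrite !patchE; case: ifP => // _; rewrite mul0e.
Qed.

End ge0_integral_density.

Section normal_shift.
Local Open Scope ereal_scope.
Context (R : realType).
Local Notation leb := (@lebesgue_measure R).
Local Notation N := (@normal_prob R 0%R 1%R).

(** The density of N(s, 1) with respect to N(0, 1). *)
Definition shift_wt (s x : R) : R := expR (s * x - s ^+ 2 / 2).

Lemma measurable_shift_wt s : measurable_fun setT (shift_wt s).
Proof.
by apply: measurableT_comp => //; exact: measurable_funB.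
Qed.

Lemma lebesgue_measure_shift (s : R) (A : set R) : measurable A ->
  pushforward leb ((fun x => x + s)%R : _ -> measurableTypeR R) A = leb A.
Proof.
move=> mA; apply/esym/lebesgue_measure_unique => //=.
  exact: measurable_funD.
move=> _ _ [[a b]] _ <-; rewrite /pushforward.
have -> : (fun x : R => x + s)%R @^-1` `]a, b]%classic
    = `](a - s)%R, (b - s)%R]%classic.
  by apply/seteqP; split => x /=; rewrite !in_itv/= ltrBlDr lerBrDr.
rewrite !lebesgue_measure_itv/= !lte_fin ltrD2r.
by case: ifP => // _; rewrite -!EFinD; congr (_%:E); rewrite opprB addrA subrK.
Qed.

Lemma normal_pdf_shift (s x : R) :
  normal_pdf 0 1 (x - s) = (shift_wt s x * normal_pdf 0 1 x)%R.
Proof.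
rewrite /normal_pdf (negbTE (oner_neq0 _)) mulrCA; congr (_ * _)%R.
rewrite /normal_fun /shift_wt -expRD; congr expR.
by rewrite expr1n; field.
Qed.

Lemma normal_prob_shift (s : R) (A : set R) : measurable A ->
  N ((fun x => x + s)%R @^-1` A) = \int[N]_(x in A) (shift_wt s x)%:E.
Proof.
move=> mA; rewrite (@ge0_integral_density_in _ _ _ leb N (normal_pdf 0 1))//.
- under eq_integral do rewrite -EFinM -normal_pdf_shift.
  pose sh := (fun x => x + s)%R : _ -> measurableTypeR R.
  have msh : measurable_fun setT sh by exact: measurable_funD.
  (* Lebesgue measure is replaced by its own image under the shift, which turns the change of
     variables into an integral against a pushforward. *)
  rewrite [RHS](eq_measure_integral (pushforward leb sh)) => //; last first.
    by move=> B mB _; exact/esym/lebesgue_measure_shift.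
  rewrite ge0_integral_pushforward//.
  - by apply: eq_integral => x _; rewrite /= /sh addrK.
  - apply: measurable_funTS; apply/measurable_EFinP; apply: measurableT_comp.
      exact: measurable_normal_pdf.
    exact: measurable_funB.
  - by move=> x _; rewrite lee_fin normal_pdf_ge0.
- exact: measurable_normal_pdf.
- by move=> x; exact: normal_pdf_ge0.
- by apply/measurable_EFinP; exact: measurable_shift_wt.
- by move=> x; rewrite lee_fin expR_ge0.
Qed.

End normal_shift.

(** * Shifts of a standard Gaussian vector *)

Section finite_product_space.
Context (R : realType) (I : finType).

Definition box (B : I -> set R) : set (I -> R) := [set x | forall i, B i (x i)].

Definition boxes : set (set (I -> R)) :=
  [set box B | B in [set B | forall i, measurable (B i)]].

(** The product sigma-algebra on R^I. The index type is arbitrary because it is later a disjoint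
    union, with one summand for each noise vector. *)
Definition finfunspace := g_sigma_algebraType boxes.

Lemma measurable_box (B : I -> set R) : (forall i, measurable (B i)) ->
  measurable (box B : set finfunspace).
Proof. by move=> mB; apply: sub_sigma_algebra; exists B. Qed.

Lemma boxE (B : I -> set R) :
  box B = \bigcap_(i in [set: I]) ((fun x : I -> R => x i) @^-1` B i).
Proof. by apply/seteqP; split => x /= h i; [move=> _; exact: h|exact: h]. Qed.

Lemma measurable_coord i : measurable_fun setT (fun x : finfunspace => x i).
Proof.
move=> _ B mB; rewrite setTI.
have -> : (fun x : finfunspace => x i) @^-1` B =
    box (fun j => if j == i then B else setT).
  apply/seteqP; split => x /=.
    by move=> Bx j; case: eqP => // ->.
  by move=> /(_ i); rewrite eqxx.
by apply: measurable_box => j; case: ifP.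
Qed.

Lemma measurable_finfunspaceP d (T : measurableType d) (f : T -> finfunspace) :
  (forall i, measurable_fun setT (fun t => f t i)) -> measurable_fun setT f.
Proof.
move=> mf; apply: (@measurability _ _ T finfunspace setT f boxes erefl).
move=> _ [_ [B mB <-] <-]; rewrite setTI boxE preimage_bigcap.
apply: fin_bigcap_measurable => [|i _]; first exact: finite_finset.
by rewrite -[X in measurable X]setTI; exact: mf.
Qed.

(** Boxes are stable under intersection and include the whole space, so the constant sequence [setT]
    is an exhaustion by boxes of finite measure. *)
Lemma finfunspace_measure_unique (m1 m2 : {measure set finfunspace -> \bar R}) :
  (forall B, (forall i, measurable (B i)) -> m1 (box B) = m2 (box B)) ->
  (m1 setT < +oo)%E -> forall A, measurable A -> m1 A = m2 A.
Proof.
move=> m12 m1oo A mA.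
have GT : boxes setT by exists (fun=> setT) => //; apply/seteqP; split.
apply: (@measure_unique _ R finfunspace boxes (fun=> setT) erefl) => //.
- move=> _ _ [B mB <-] [B' mB' <-]; exists (fun i => B i `&` B' i).
    by move=> i; exact: measurableI.
  apply/seteqP; split => x /=; first by move=> h; split => i; have [] := h i.
  by case=> h h' i; split; [exact: h|exact: h'].
- by rewrite bigcup_const.
- by move=> _ [B mB <-]; exact: m12.
Qed.

End finite_product_space.

Section gaussian_shift.
Local Open Scope ereal_scope.
Context d (T : measurableType d) (R : realType) (P : probability T R).
Context (I : finType) (xi : I -> T -> R).
Local Notation N := (@normal_prob R 0%R 1%R).
Local Notation V := (finfunspace R I).

(** The product formula on boxes encodes both the marginal laws and the independence: take [B j] to
    be [setT] for the other indices. *)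
Definition iid_std_normal : Prop :=
  (forall i, measurable_fun setT (xi i)) /\
  forall B : I -> set R, (forall i, measurable (B i)) ->
    P (\bigcap_(i in [set: I]) (xi i @^-1` B i)) = \prod_(i : I) N (B i).

Hypothesis xiP : iid_std_normal.

Let mxi i : measurable_fun setT (xi i). Proof. exact: xiP.1. Qed.

Let Xi (t : T) : V := fun i => xi i t.

Let mXi : measurable_fun setT Xi.
Proof. exact: measurable_finfunspaceP. Qed.

Let P_box (B : I -> set R) : (forall i, measurable (B i)) ->
  P (Xi @^-1` box B) = \prod_(i : I) N (B i).
Proof. by move=> mB; rewrite -xiP.2// boxE preimage_bigcap. Qed.

Definition translate (s : I -> R) (x : I -> R) : I -> R := (fun i => x i + s i)%R.

Lemma measurable_translate s :
  measurable_fun setT (translate s : V -> V).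
Proof.
apply: measurable_finfunspaceP => i; apply: measurable_funD => //.
exact: measurable_coord.
Qed.

Let spike (i : I) (s : R) : I -> R := fun j => if j == i then s else 0%R.

(** Restrict [P] to the event [C] that constrains the coordinates other than [i]. By independence
    the image of this restriction under [xi i] is the normal law times the constant [c]. *)
Let integral_box_coord (i : I) (B : I -> set R) (f : R -> R) :
  (forall i, measurable (B i)) ->
  measurable_fun setT f -> (forall x, (0 <= f x)%R) ->
  \int[P]_(t in Xi @^-1` box B) (f (xi i t))%:E =
  \int[N]_(x in B i) (f x)%:E * \prod_(j | j != i) N (B j).
Proof.
move=> mB mf f0.
pose c := \prod_(j | j != i) N (B j).
have c0 : 0 <= c by apply: prode_ge0.
have cfin : c \is a fin_num.
  apply: prode_fin_num => j _. exact: (fin_num_measure N _ (mB j)).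
pose c' : {nonneg R} := NngNum (fine_ge0 c0).
pose C := Xi @^-1` box (fun j => if j == i then setT else B j).
have mC : measurable C.
  rewrite -[X in measurable X]setTI; apply: mXi => //.
  by apply: measurable_box => j; case: ifP.
have BC S : C `&` xi i @^-1` S = Xi @^-1` box (fun j => if j == i then S else B j).
  apply/seteqP; split => t /=.
    by case=> h hS j; move: (h j); case: eqP => // ->.
  move=> h; split; last by move: (h i); rewrite eqxx.
  by move=> j; move: (h j); case: eqP.
have m1C : measurable_fun setT (\1_C : T -> R) by exact: measurable_indic.
have p1C t : (0 <= (\1_C : T -> R) t)%R by [].
pose nu := mdensity P m1C p1C.
pose xii : T -> measurableTypeR R := xi i.
have nuE S : measurable S -> pushforward nu xii S = mscale c' N S.
  move=> mS; rewrite /pushforward /nu /mdensity integral_indic//=; last first.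
    by rewrite -[X in measurable X]setTI; exact: mxi.
  rewrite BC P_box; last by move=> j; case: ifP.
  rewrite (bigD1 i)//= eqxx /mscale/= fineK// muleC; congr (_ * _).
  by apply: eq_bigr => j /negbTE ->.
rewrite muleC -/c -[c in RHS]fineK//.
have mfE : measurable_fun setT (EFin \o f) by exact/measurable_EFinP.
rewrite -(ge0_integral_mscale N (mB i) c')//; first last.
- by move=> x _; rewrite lee_fin.
- by apply/measurable_EFinP; exact: measurable_funTS.
have mxii : measurable_fun setT xii by exact: mxi.
rewrite [RHS](eq_measure_integral (pushforward nu xii)) => [//|S mS _]; last first.
  exact/esym/nuE.
have mBi : measurable (xi i @^-1` B i).
  by rewrite -[X in measurable X]setTI; exact: mxi.
have mfxi : measurable_fun setT (fun t => (f (xi i t))%:E).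
  exact: (measurableT_comp mfE).
rewrite ge0_integral_pushforward//; first last.
- by move=> x _; rewrite lee_fin.
- by apply/measurable_EFinP; exact: measurable_funTS.
- exact: mB.
rewrite [RHS](@ge0_integral_density_in _ _ _ P nu _ m1C p1C)//; last first.
  by move=> t; rewrite lee_fin.
have -> : Xi @^-1` box B = xi i @^-1` B i `&` C.
  rewrite setIC BC; congr (_ @^-1` box _); apply/funext => j.
  by case: eqP => // ->.
rewrite integral_mkcondr; apply: eq_integral => t _.
by rewrite epatch_indic.
Qed.

(** Both sides integrate [F] against finite measures on [V]. It is enough to compare these on boxes,
    where only coordinate [i] differs and [normal_prob_shift] applies. *)
Let integral_translate_spike (i : I) (s : R) (F : V -> \bar R) :
  measurable_fun setT F -> (forall x, 0 <= F x) ->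
  \int[P]_t F (translate (spike i s) (Xi t)) =
  \int[P]_t (F (Xi t) * (shift_wt s (xi i t))%:E).
Proof.
move=> mF F0.
pose sh := translate (spike i s) : V -> V.
have msh : measurable_fun setT (sh \o Xi).
  by apply: measurableT_comp => //; exact: measurable_translate.
have mw : measurable_fun setT (fun t => shift_wt s (xi i t)).
  by apply: measurableT_comp => //; exact: measurable_shift_wt.
have w0 t : (0 <= shift_wt s (xi i t))%R by exact: expR_ge0.
pose nu := mdensity P mw w0.
have key A : measurable A -> pushforward P (sh \o Xi) A = pushforward nu Xi A.
  apply: finfunspace_measure_unique => //; last first.
    by rewrite (_ : _ setT = P setT)// probability_setT ltry.
  move=> B mB; rewrite /pushforward /nu /mdensity.
  rewrite [RHS](@integral_box_coord i B (shift_wt s))//; first last.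
  - by move=> x; exact: expR_ge0.
  - exact: measurable_shift_wt.
  pose B' j := (fun x => x + spike i s j)%R @^-1` B j.
  rewrite [LHS](_ : _ = P (Xi @^-1` box B')) // P_box; last first.
    move=> j; rewrite -[X in measurable X]setTI.
    have : measurable_fun setT (fun x : R => x + spike i s j)%R.
      exact: measurable_funD.
    by apply.
  rewrite (bigD1 i)//= /B' /spike eqxx normal_prob_shift//; congr (_ * _).
  apply: eq_bigr => j /negbTE ->; congr N; apply/funext => x /=.
  by rewrite addr0.
transitivity (\int[pushforward P (sh \o Xi)]_x F x).
  by rewrite ge0_integral_pushforward.
rewrite (eq_measure_integral (pushforward nu Xi)) => //; last first.
  by move=> A mA _; exact: key.
rewrite ge0_integral_pushforward// preimage_setT.
rewrite (@ge0_integral_density _ _ _ P nu _ mw)//; first exact: measurableT_comp.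
by move=> t; exact: F0.
Qed.

Lemma cameron_martin (s : I -> R) (F : V -> \bar R) :
  measurable_fun setT F -> (forall x, 0 <= F x) ->
  \int[P]_t F (translate s (fun i => xi i t)) =
  \int[P]_t (F (fun i => xi i t) * (\prod_i shift_wt (s i) (xi i t))%:E).
Proof.
(* Coordinates are shifted one at a time, along a list without repetition: the weight already
   produced by [i] is then left unchanged by the shifts still to come. *)
suff H (r : seq I) : uniq r -> forall F : V -> \bar R,
    measurable_fun setT F -> (forall x, 0 <= F x) ->
    \int[P]_t F (translate (fun i => if i \in r then s i else 0%R) (Xi t)) =
    \int[P]_t (F (Xi t) * (\prod_(i <- r) shift_wt (s i) (xi i t))%:E).
  move=> mF F0; have := H _ (index_enum_uniq I) F mF F0.
  by under eq_integral do under eq_fun do rewrite mem_index_enum.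
elim: r => [_ G mG G0|i r IH /= /andP[ir ur] G mG G0].
  apply: eq_integral => t _; rewrite big_nil mule1; congr G.
  by apply/funext => i; rewrite /translate in_nil addr0.
pose sr j := if j \in r then s j else 0%R.
transitivity (\int[P]_t (G \o translate sr) (translate (spike i (s i)) (Xi t))).
  apply: eq_integral => t _; congr G; apply/funext => j.
  rewrite /translate /= /spike /sr in_cons -addrA; congr (_ + _)%R.
  by case: eqP => [->|_] /=; rewrite ?(negbTE ir) ?addr0 ?add0r.
rewrite integral_translate_spike; first last.
- by move=> x; exact: G0.
- by apply: (measurableT_comp mG); exact: measurable_translate.
pose H x := G x * (shift_wt (s i) (x i))%:E.
transitivity (\int[P]_t H (translate sr (Xi t))).
  apply: eq_integral => t _; rewrite /H /=; congr (_ * (shift_wt _ _)%:E).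
  by rewrite /translate /sr (negbTE ir) addr0.
rewrite IH//.
- apply: eq_integral => t _.
  by rewrite /H big_cons EFinM muleA.
- apply: emeasurable_funM => //; apply/measurable_EFinP.
  apply: measurableT_comp; first exact: measurable_shift_wt.
  exact: measurable_coord.
- by move=> x; rewrite mule_ge0// lee_fin expR_ge0.
Qed.

End gaussian_shift.

(** * Generated sigma-algebras and elementary exponential bounds *)

Lemma sigma_algebra_sigma_vec d (T : measurableType d) (R : realType) (k : nat)
    (Y : T -> 'cV[R]_k) : sigma_algebra setT (sigma_vec Y).
Proof. exact: smallest_sigma_algebra. Qed.

Lemma sigma_vec_sub d (T : measurableType d) (R : realType) (k : nat)
    (Y : T -> 'cV[R]_k) (S : set (set T)) : sigma_algebra setT S ->
  (forall i (B : set R), measurable B -> S ((fun t => Y t i 0) @^-1` B)) ->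
  sigma_vec Y `<=` S.
Proof.
move=> sS YS; apply: smallest_sub => // A; rewrite -bigcup_seq => -[i _ [B mB <-]].
by rewrite setTI; exact: YS.
Qed.

Lemma sigma_vec_coord d (T : measurableType d) (R : realType) (k : nat)
    (Y : T -> 'cV[R]_k) i (B : set R) : measurable B ->
  sigma_vec Y ((fun t => Y t i 0) @^-1` B).
Proof.
move=> mB; apply: sub_sigma_algebra; rewrite -bigcup_seq.
by exists i; [rewrite /= mem_index_enum|exists B => //; rewrite setTI].
Qed.

Lemma sigma_vec_measurable d (T : measurableType d) (R : realType) (k : nat)
    (Y : T -> 'cV[R]_k) :
  (forall i, measurable_fun setT (fun t => Y t i 0)) ->
  sigma_vec Y `<=` measurable.
Proof.
move=> mY; apply: sigma_vec_sub; first exact: sigma_algebra_measurable.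
by move=> i B mB; rewrite -[X in measurable X]setTI; exact: mY.
Qed.

Lemma normr_le_expRD (R : realType) (x : R) : `|x| <= expR x + expR (- x).
Proof.
have h1 := expR_ge1Dx x; have h2 := expR_ge1Dx (- x).
have p1 := expR_gt0 x; have p2 := expR_gt0 (- x).
by rewrite ler_norml; apply/andP; split; lra.
Qed.

(** From 1 - x <= exp (- x) follows exp x <= 1 / (1 - x), which is at most 1 + 2 x up to x = 1/2. *)
Lemma expR_sub1_le (R : realType) (x : R) : 0 <= x <= 1 / 2 -> expR x - 1 <= 2 * x.
Proof.
move=> /andP[x0 x2]; have := expR_ge1Dx (- x); rewrite expRN.
have e0 := expR_gt0 x.
rewrite -(ler_pM2r e0) mulVf ?gt_eqF// => h.
by nra.
Qed.

(** * Integrals of linear forms over shift-invariant events *)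

Section gaussian_orthogonality.
Local Open Scope ereal_scope.
Context d (T : measurableType d) (R : realType) (P : probability T R).
Context (I : finType) (xi : I -> T -> R).
Hypothesis xiP : iid_std_normal P xi.
Local Notation V := (finfunspace R I).

Definition lincomb (a : I -> R) (t : T) : R := (\sum_i a i * xi i t)%R.

Let mxi i : measurable_fun setT (xi i). Proof. exact: xiP.1. Qed.

Lemma measurable_lincomb a : measurable_fun setT (lincomb a).
Proof. by apply: measurable_sum => i; exact: measurable_funM. Qed.

Let sqn (a : I -> R) : R := (\sum_i a i ^+ 2)%R.

Let prod_wt a t : (\prod_i shift_wt (a i) (xi i t) =
  expR (lincomb a t) * expR (- (sqn a / 2)))%R.
Proof.
rewrite -expRD /shift_wt -expR_sum sumrB; congr expR.
by rewrite /sqn mulr_suml.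
Qed.

Let mexp a : measurable_fun setT (fun t => expR (lincomb a t)).
Proof. by apply: measurableT_comp => //; exact: measurable_lincomb. Qed.

Let integral_invariant (a : I -> R) (B : set V) : measurable B ->
  translate a @^-1` B = B ->
  \int[P]_(t in (fun t i => xi i t) @^-1` B) (expR (lincomb a t))%:E =
  P ((fun t i => xi i t) @^-1` B) * (expR (sqn a / 2))%:E.
Proof.
move=> mB aB; set A := _ @^-1` B.
have mA : measurable A.
  rewrite -[X in measurable X]setTI.
  have : measurable_fun setT ((fun t i => xi i t) : T -> V).
    exact: measurable_finfunspaceP.
  by apply.
have := @cameron_martin _ _ _ _ _ _ xiP a (fun x => (\1_B x)%:E).
move=> /(_ _)/(_ _) h.
have {h} := h.
rewrite (_ : (\int[P]_t _) = P A); last first.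
  transitivity (\int[P]_t (\1_A t)%:E); last by rewrite integral_indic// setIT.
  apply: eq_integral => t _; congr (_%:E).
  rewrite !indicE (_ : (_ \in B) = (t \in A))//.
  have aBx x : B (translate a x) = B x := congr1 (fun S : set V => S x) aB.
  by apply/idP/idP; rewrite !inE /A /= aBx.
move=> ->; last 2 first.
- by apply/measurable_EFinP; exact: measurable_indic.
- by move=> x; rewrite lee_fin.
under [in RHS]eq_integral do rewrite prod_wt EFinM muleA.
rewrite ge0_integralZr//; last first.
  apply: emeasurable_funM; last exact/measurable_EFinP.
  by apply/measurable_EFinP; exact: (measurable_indic mA).
rewrite -muleA -EFinM -expRD addNr expR0 mule1 [LHS]integral_mkcond.
by apply: eq_integral => t _; rewrite epatch_indic muleC.
Qed.

(** The whole space is invariant under every shift, so the moment generating function is a case of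
    [integral_invariant]. *)
Lemma integral_expR_lincomb a :
  \int[P]_t (expR (lincomb a t))%:E = (expR (sqn a / 2))%:E.
Proof.
have := @integral_invariant a setT measurableT.
by rewrite !preimage_setT probability_setT mul1e; apply.
Qed.

Lemma integrable_expR_lincomb a :
  P.-integrable setT (fun t => (expR (lincomb a t))%:E).
Proof.
apply/integrableP; split; first exact/measurable_EFinP.
under eq_integral do rewrite gee0_abs ?lee_fin ?expR_ge0//.
by rewrite integral_expR_lincomb ltry.
Qed.

Let lincombZ c a t : lincomb (fun i => c * a i)%R t = (c * lincomb a t)%R.
Proof. by rewrite /lincomb mulr_sumr; apply: eq_bigr => i _; rewrite mulrA. Qed.

Lemma integrable_lincomb a : P.-integrable setT (fun t => (lincomb a t)%:E).
Proof.
apply: (@le_integrable _ _ _ _ _ measurableT _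
   ((fun t => (expR (lincomb a t))%:E) \+
    (fun t => (expR (lincomb (fun i => (-1) * a i)%R t))%:E))).
- by apply/measurable_EFinP; exact: measurable_lincomb.
- move=> t _ /=; rewrite lincombZ mulN1r lee_fin.
  by rewrite (ger0_norm (addr_ge0 (expR_ge0 _) (expR_ge0 _))) normr_le_expRD.
- by apply: integrableD => //; exact: integrable_expR_lincomb.
Qed.

(* The density of the shifted law is bounded below by its tangent,
   [1 + x <= expR x], so that no differentiation under the integral is needed. *)
Lemma integral_lincomb_invariant (a : I -> R) (B : set V) : measurable B ->
  (forall c, translate (fun i => c * a i)%R @^-1` B = B) ->
  \int[P]_(t in (fun t i => xi i t) @^-1` B) (lincomb a t)%:E = 0.
Proof.
move=> mB aB; set A := _ @^-1` B.
have mA : measurable A.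
  rewrite -[X in measurable X]setTI.
  have : measurable_fun setT ((fun t i => xi i t) : T -> V).
    exact: measurable_finfunspaceP.
  by apply.
have intA : P.-integrable A (fun t => (lincomb a t)%:E).
  exact: (integrableS measurableT mA (@subsetT _ _) (integrable_lincomb a)).
have := integrable_fin_num mA intA.
set m := \int[P]_(t in A) _; move=> mfin.
rewrite -[m]fineK//; congr (_%:E); set m' := fine m.
pose c := (sqn a / 2)%R.
have c0 : (0 <= c)%R by rewrite divr_ge0// sumr_ge0// => i _; exact: sqr_ge0.
(* Integrating the tangent bound over [A] gives P A + e m' <= P A exp (e^2 c). Since P A <= 1 and
   the exponential is at least 1, P A can be eliminated. *)
have ineq (e : R) : (e * m' <= expR (e ^+ 2 * c) - 1)%R.
  have := integral_invariant mB (aB e); rewrite -/A => h.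
  have : \int[P]_(t in A) (1 + e * lincomb a t)%:E <=
         \int[P]_(t in A) (expR (lincomb (fun i => e * a i)%R t))%:E.
    apply: le_integral => //.
    - under eq_fun do rewrite EFinD EFinM.
      apply: integrableD => //; last exact: integrableZl.
      exact: (finite_measure_integrable_cst P 1 mA).
    - exact: (integrableS measurableT mA (@subsetT _ _) (integrable_expR_lincomb _)).
    - by move=> t _; rewrite lee_fin lincombZ expR_ge1Dx.
  rewrite h (_ : sqn _ = e ^+ 2 * sqn a)%R; last first.
    by rewrite /sqn mulr_sumr; apply: eq_bigr => i _; rewrite exprMn.
  rewrite -mulrA -/c.
  under eq_integral do rewrite EFinD EFinM.
  rewrite integralD//; last 2 first.
  - exact: (finite_measure_integrable_cst P 1 mA).
  - exact: integrableZl.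
  have -> : \int[P]_(x in A) 1 = P A by rewrite integral_cst// mul1e.
  rewrite integralZl// -/m -[m]fineK// -/m'.
  have PA1 := probability_le1 P mA.
  have PA0 : 0 <= P A by [].
  have PAf : P A \is a fin_num by exact: fin_num_measure.
  move: PA0 PA1; rewrite -(fineK PAf) -!EFinM -EFinD !lee_fin.
  move=> p0 p1 hle.
  have e1 : (1 <= expR (e ^+ 2 * c))%R.
    have := expR_ge1Dx (e ^+ 2 * c); apply: le_trans.
    by rewrite lerDl mulr_ge0// sqr_ge0.
  by nra.
apply/eqP; apply: contraT => m0.
(* In [ineq] the left side is linear in e and the right side quadratic near 0, so e = m' / D with D
   large is contradictory. The summand 4 c gives 2 c / D <= 1/2; the other two keep e^2 c below 1/2,
   as [expR_sub1_le] requires. What remains is m'^2 / D <= (m'^2 / D) (1/2). *)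
pose D := (4 * c + 2 * (c * m' ^+ 2) + 4)%R.
have cm0 : (0 <= c * m' ^+ 2)%R by rewrite mulr_ge0// sqr_ge0.
have D0 : (0 < D)%R by rewrite /D; lra.
have := ineq (m' / D)%R.
have dD : (D^-1 * D = 1)%R by rewrite mulVf// gt_eqF.
have iD : (0 < D^-1)%R by rewrite invr_gt0.
have mm : (0 < m' ^+ 2)%R by rewrite exprn_even_gt0.
have D4 : (D^-1 <= 1)%R by rewrite invf_le1//; rewrite /D; lra.
have cD : (2 * (c * D^-1) <= 1 / 2)%R.
  by have : (D^-1 * D = 1)%R by []; rewrite /D; nra.
have cmD : (c * m' ^+ 2 * D^-1 <= 1 / 2)%R.
  by have : (D^-1 * D = 1)%R by []; rewrite /D; nra.
have xb : (0 <= (m' / D) ^+ 2 * c <= 1 / 2)%R.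
  have -> : ((m' / D) ^+ 2 * c = c * m' ^+ 2 * D^-1 * D^-1)%R by field; rewrite gt_eqF.
  apply/andP; split; first exact: mulr_ge0 (mulr_ge0 cm0 (ltW iD)) (ltW iD).
  by rewrite (le_trans _ cmD)// ler_piMr// (mulr_ge0 cm0 (ltW iD)).
move=> /le_trans /(_ (expR_sub1_le xb)).
have -> : (m' / D * m' = m' ^+ 2 * D^-1)%R by field; rewrite gt_eqF.
have -> : (2 * ((m' / D) ^+ 2 * c) = (m' ^+ 2 * D^-1) * (2 * (c * D^-1)))%R.
  by field; rewrite gt_eqF.
have := mulr_gt0 mm iD; set z := (_ * D^-1)%R => z0.
rewrite -[leLHS]mulr1 ler_pM2l// => /le_trans /(_ cD).
by lra.
Qed.

(** An event of [sigma_vec y] is known only through generators. The preimages under [xi] of sets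
    invariant along [a] form a sigma-algebra, and it contains those generators because each [M j] is
    orthogonal to [a]. *)
Lemma integral_orthogonal (k : nat) (y : T -> 'cV[R]_k) (b : 'I_k -> R)
    (M : 'I_k -> I -> R) (a : I -> R) :
  (forall t j, y t j 0 = b j + lincomb (M j) t)%R ->
  (forall j, \sum_i M j i * a i = 0)%R ->
  forall A, sigma_vec y A -> \int[P]_(t in A) (lincomb a t)%:E = 0.
Proof.
move=> yE Ma A yA.
pose inv (B : set V) := forall c, translate (fun i => c * a i)%R @^-1` B = B.
pose S := [set A | exists B : set V,
    [/\ measurable B, inv B & A = (fun t i => xi i t) @^-1` B]].
suff /(_ _ yA)[B [mB invB ->]] : sigma_vec y `<=` S.
  exact: integral_lincomb_invariant.
apply: sigma_vec_sub => [|j U mU]; last first.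
  pose g (x : V) := (b j + \sum_i M j i * x i)%R.
  exists (g @^-1` U); split.
  - rewrite -[X in measurable X]setTI.
    have : measurable_fun setT g.
      apply: measurable_funD => //; apply: measurable_sum => i.
      by apply: measurable_funM => //; exact: measurable_coord.
    by apply.
  - move=> c; apply/funext => x /=; congr (U _); rewrite /g; congr (_ + _)%R.
    under eq_bigr do rewrite /translate mulrDr mulrCA.
    by rewrite big_split/= -mulr_sumr Ma mulr0 addr0.
  - by apply/funext => t /=; rewrite yE.
split.
- exists set0; split; first exact: measurable0.
    by move=> c; rewrite preimage_set0.
  by rewrite preimage_set0.
- move=> _ [B [mB iB ->]]; exists (~` B); split; first exact: measurableC.
    by move=> c; rewrite -[in RHS](iB c).
  by rewrite setTD preimage_setC.
- move=> F hF.
  pose G n := projT1 (cid (hF n)).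
  have GP n : [/\ measurable (G n : set V), inv (G n) &
      F n = (fun t i => xi i t) @^-1` (G n)] by exact: projT2 (cid (hF n)).
  exists (\bigcup_n G n); split.
  - by apply: bigcupT_measurable => n; have [] := GP n.
  - move=> c; rewrite preimage_bigcup; apply: eq_bigcupr => n _.
    by have [_ ->] := GP n.
  - rewrite preimage_bigcup; apply: eq_bigcupr => n _.
    by have [_ _ ->] := GP n.
Qed.

End gaussian_orthogonality.

(** * Conditional expectations and Gaussian families *)

Section condexp_theory.
Context d (T : measurableType d) (R : realType) (P : probability T R).
Context (F : set (set T)).
Hypotheses (sF : sigma_algebra setT F) (mF : F `<=` measurable).

Lemma sub_measurable_affine (k : nat) (b : R) (c : 'I_k -> R)
    (f : 'I_k -> T -> R) :
  (forall j (B : set R), measurable B -> F (f j @^-1` B)) ->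
  forall B : set R, measurable B ->
    F ((fun t => b + \sum_j c j * f j t) @^-1` B).
Proof.
move=> mf B mB.
(* On the type that carries [F] as its sigma-algebra, measurability of sums and products is
   available; [sF] then identifies its measurable sets with [F]. *)
pose g (t : g_sigma_algebraType F) := b + \sum_j c j * f j t.
suff : measurable_fun setT g.
  move=> /(_ measurableT B mB).
  by rewrite setTI (measurable_g_measurableTypeE sF).
apply: measurable_funD => //; apply: measurable_sum => j.
apply: measurable_funM => // _ A mA.
by rewrite setTI (measurable_g_measurableTypeE sF); exact: mf.
Qed.

Lemma is_condexp_affine (k p : nat) (M : 'M[R]_(p, k)) (b : 'cV[R]_p)
    (X h : T -> 'cV[R]_k) :
  is_condexp P F X h ->
  is_condexp P F (fun t => b + M *m X t) (fun t => b + M *m h t).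
Proof.
move=> Xh i.
have E (Y : T -> 'cV[R]_k) :
    (fun t => (b + M *m Y t) i 0) = (fun t => b i 0 + \sum_j M i j * Y t j 0).
  by apply/funext => t; rewrite !mxE.
have EE (Y : T -> 'cV[R]_k) : (fun t => ((b + M *m Y t) i 0)%:E) =
    (fun t => (b i 0)%:E + \sum_j ((M i j)%:E * (Y t j 0)%:E))%E.
  by apply/funext => t; rewrite sumEFin -EFinD; have /(congr1 (@^~ t))-> := E Y.
have intS (Y : T -> 'cV[R]_k) A : measurable A ->
    (forall j, P.-integrable setT (fun t => (Y t j 0)%:E)) -> forall j,
    P.-integrable A (fun t => ((M i j)%:E * (Y t j 0)%:E)%E).
  move=> mA iY j; apply: integrableZl => //.
  exact: (integrableS measurableT mA (@subsetT _ _) (iY j)).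
have iX j : P.-integrable setT (fun t => (X t j 0)%:E) by have [] := Xh j.
have ih j : P.-integrable setT (fun t => (h t j 0)%:E) by have [] := Xh j.
have intcst A : measurable A -> P.-integrable A (fun=> (b i 0)%:E).
  by move=> mA; exact: (finite_measure_integrable_cst P (b i 0) mA).
have iD (Y : T -> 'cV[R]_k) A : measurable A ->
    (forall j, P.-integrable setT (fun t => (Y t j 0)%:E)) ->
    P.-integrable A (fun t => \sum_j ((M i j)%:E * (Y t j 0)%:E))%E.
  by move=> mA iY; apply: integrable_sum => // j _; exact: intS.
split.
- by rewrite EE; apply: integrableD => //; [exact: intcst|exact: iD].
- by rewrite EE; apply: integrableD => //; [exact: intcst|exact: iD].
- by rewrite E; apply: sub_measurable_affine => j; have [] := Xh j.
- move=> A FA; have mA := mF FA; rewrite (EE X) (EE h).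
  rewrite !integralD//; try exact: intcst; try exact: iD.
  congr (_ + _)%E; rewrite !integral_sum//; try exact: intS.
  apply: eq_bigr => j _.
  rewrite !integralZl//; try exact: (integrableS measurableT mA (@subsetT _ _)).
  by congr (_ * _)%E; have [_ _ _ ->] := Xh j.
Qed.

(** [f] keeps its own form, such as [benchmarked]; [M] and [b] only witness that it is affine. *)
Lemma is_condexp_ext_affine (k p : nat) (f : 'cV[R]_k -> 'cV[R]_p)
    (X h : T -> 'cV[R]_k) (M : 'M[R]_(p, k)) (b : 'cV[R]_p) :
  (forall x, f x = b + M *m x) -> is_condexp P F X h ->
  is_condexp P F (fun t => f (X t)) (fun t => f (h t)).
Proof.
move=> fE /(is_condexp_affine M b).
by under eq_fun do rewrite -fE; under [X in is_condexp _ _ _ X]eq_fun do rewrite -fE.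
Qed.

(** The residual is what Gaussian orthogonality controls; integrability of [h] comes from that of
    [X] and of [X - h]. *)
Lemma is_condexp_residual (k : nat) (X h : T -> 'cV[R]_k) :
  (forall i, P.-integrable setT (fun t => (X t i 0)%:E)) ->
  (forall i (B : set R), measurable B -> F ((fun t => h t i 0) @^-1` B)) ->
  (forall i, P.-integrable setT (fun t => ((X t - h t) i 0)%:E)) ->
  (forall i A, F A -> \int[P]_(t in A) ((X t - h t) i 0)%:E = 0)%E ->
  is_condexp P F X h.
Proof.
move=> iX mh ir r0 i.
have hE : (fun t => (h t i 0)%:E) =
    (fun t => (X t i 0)%:E - ((X t - h t) i 0)%:E)%E.
  by apply/funext => t; rewrite !mxE -EFinB opprB addrC subrK.
split => //; first by rewrite hE; exact: integrableB.
- by move=> B; exact: mh.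
- move=> A FA; have mA := mF FA; rewrite hE integralB//; last 2 first.
  + exact: (integrableS measurableT mA (@subsetT _ _)).
  + exact: (integrableS measurableT mA (@subsetT _ _) (ir i)).
  by rewrite r0// sube0.
Qed.

End condexp_theory.

(** * Independent Gaussian vectors and their uncorrelated linear images *)

Section gaussian_family.
Context d (T : measurableType d) (R : realType) (P : probability T R).
Context (K : finType) (m : K -> nat) (v : forall s, T -> 'cV[R]_(m s)).
Context (Sig : forall s, 'M[R]_(m s)).
Hypothesis vN : forall s, is_mvnormal P (v s) 0 (Sig s).
Hypothesis vI : mutually_independent P (fun s => sigma_vec (v s)).

(** The standard normal coordinates of all the vectors are placed side by side. Those of one vector
    are independent by [is_mvnormal]; across vectors, independence is inherited because the
    coordinates of [v s] are measurable for [sigma_vec (v s)]. *)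
Lemma gaussian_family_coords : exists (I : finType) (xi : I -> T -> R)
    (a : forall s, 'I_(m s) -> I -> R),
  [/\ iid_std_normal P xi,
      forall s j t, v s t j 0 = lincomb xi (a s j) t,
      forall s j j', \sum_i a s j i * a s j' i = Sig s j j' &
      forall s s' j j', s != s' -> \sum_i a s j i * a s' j' i = 0].
Proof.
pose r s := projT1 (cid (vN s)).
pose S s : 'M[R]_(m s, r s) := projT1 (cid (projT2 (cid (vN s)))).
pose z s : 'I_(r s) -> {RV P >-> R} :=
  projT1 (cid (projT2 (cid (projT2 (cid (vN s)))))).
have zP s : [/\ row_free (S s)^T, S s *m (S s)^T = Sig s,
    (forall i (B : set R), measurable B ->
           distribution P (z s i) B = normal_prob 0 1 B),
    mutually_independent P (fun i => g_sigma_algebra_preimage (z s i)) &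
    forall t, v s t = 0 + S s *m \col_i z s i t].
  exact: projT2 (cid (projT2 (cid (projT2 (cid (vN s)))))).
pose I : finType := {s : K & 'I_(r s)}.
pose xi (i : I) : T -> R := z (tag i) (tagged i).
(* The default 0 extends a row of [S s] to the coordinates of the other vectors, whence the
   orthogonality for [s != s']. *)
pose a s j (i : I) : R := untag 0 (fun l : 'I_(r s) => S s j l) i.
have aE s j l : a s j (Tagged (fun s => 'I_(r s)) l) = S s j l.
  by rewrite /a (@untagE _ _ _ 0 s (fun l => S s j l) (Tagged (fun s => 'I_(r s)) l) erefl).
have a0 s j s' (l : 'I_(r s')) : s' != s ->
    a s j (Tagged (fun s => 'I_(r s)) l) = 0.
  by move=> ss'; rewrite /a untag_dflt.
have sumE s j (f : I -> R) :
    \sum_i a s j i * f i = \sum_l S s j l * f (Tagged (fun s => 'I_(r s)) l).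
  transitivity (\sum_s' \sum_(l : 'I_(r s'))
      a s j (Tagged (fun s => 'I_(r s)) l) * f (Tagged (fun s => 'I_(r s)) l)).
    by rewrite sig_big_dep/=; apply: eq_bigr => -[s' l] _.
  rewrite (bigD1 s)//= [X in _ + X]big1 ?addr0; last first.
    by move=> s' ss'; rewrite big1// => l _; rewrite a0// mul0r.
  by apply: eq_bigr => l _; rewrite aE.
exists I, xi, a; split.
- split; first by move=> i; exact: measurable_funPT.
  move=> B mB.
  pose A s := \bigcap_(l in [set: 'I_(r s)])
    (z s l @^-1` B (Tagged (fun s => 'I_(r s)) l)).
  have -> : \bigcap_(i in [set: I]) (xi i @^-1` B i) = \bigcap_(s in [set: K]) A s.
    apply/seteqP; split => t /= h; first by move=> s _ l _; exact: h.
    by move=> [s l] _; exact: h.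
  rewrite vI => [|s].
    transitivity (\prod_s \prod_(l : 'I_(r s))
        normal_prob (0 : R) 1 (B (Tagged (fun s => 'I_(r s)) l)))%E.
      apply: eq_bigr => s _; have [_ _ zN zI _] := zP s.
      rewrite zI => [|l]; first by apply: eq_bigr => l _; exact: zN.
      by exists (B (Tagged (fun s => 'I_(r s)) l)) => //; rewrite setTI.
    by rewrite sig_big_dep/=; apply: eq_bigr => -[s l] _.
  have [Sfree _ _ _ vE] := zP s.
  (* [S s] has full column rank, so the transpose of [pinvmx (S s)^T] is a left inverse of it and
     recovers the coordinates from [v s]. *)
  have zv l : (z s l : T -> R) = (fun t => 0 + \sum_j (pinvmx (S s)^T)^T l j * v s t j 0).
    apply/funext => t; rewrite add0r.
    have := congr1 (mulmx (pinvmx (S s)^T)^T) (vE t).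
    have PS : (pinvmx (S s)^T)^T *m S s = 1%:M.
      by apply: trmx_inj; rewrite trmx_mul trmxK mulmxVp// trmx1.
    rewrite add0r mulmxA PS mul1mx.
    by move=> /(congr1 (fun M : 'cV_ _ => M l 0)); rewrite !mxE => ->.
  have sS := sigma_algebra_sigma_vec (v s).
  rewrite -(measurable_g_measurableTypeE sS) /A.
  apply: (@fin_bigcap_measurable _ (g_sigma_algebraType (sigma_vec (v s)))) => [|l _].
    exact: finite_finset.
  rewrite (measurable_g_measurableTypeE sS) zv.
  by apply: sub_measurable_affine => // j U; exact: sigma_vec_coord.
- move=> s j t; have [_ _ _ _ ->] := zP s; rewrite add0r.
  rewrite /lincomb sumE !mxE; apply: eq_bigr => l _; by rewrite !mxE.
- move=> s j j'; have [_ <- _ _ _] := zP s.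
  by rewrite sumE !mxE; apply: eq_bigr => l _; rewrite aE !mxE.
- move=> s s' j j' ss'; rewrite sumE big1// => l _.
  by rewrite a0 ?mulr0.
Qed.

(** The hypothesis says that the covariance matrix of [y] and [r] vanishes; entry (j, i) is the
    inner product of the coefficient vectors of [y j] and [r i]. *)
Lemma gaussian_family_uncorrelated (k p : nat) (b : 'cV[R]_k)
    (M : forall s, 'M[R]_(k, m s)) (N : forall s, 'M[R]_(p, m s)) :
  \sum_s M s *m Sig s *m (N s)^T = 0 ->
  let y t := b + \sum_s M s *m v s t in
  let r t := \sum_s N s *m v s t in
  forall i,
    P.-integrable setT (fun t => (r t i 0)%:E) /\
    forall A, sigma_vec y A -> (\int[P]_(t in A) (r t i 0)%:E = 0)%E.
Proof.
move=> MN y r i; have [I [xi [a [xiP vE aS a0]]]] := gaussian_family_coords.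
pose co q (L : forall s, 'M[R]_(q, m s)) j (x : I) : R :=
  \sum_s \sum_l L s j l * a s l x.
have coE q (L : forall s, 'M[R]_(q, m s)) j t :
    (\sum_s L s *m v s t) j 0 = lincomb xi (co q L j) t.
  rewrite summxE /lincomb /co.
  under [RHS]eq_bigr do rewrite mulr_suml.
  rewrite exchange_big/=; apply: eq_bigr => s _; rewrite mxE.
  under [RHS]eq_bigr do rewrite mulr_suml.
  rewrite exchange_big/=; apply: eq_bigr => l _; rewrite vE /lincomb mulr_sumr.
  by apply: eq_bigr => x _; rewrite mulrA.
have rE : (fun t => (r t i 0)%:E) = (fun t => (lincomb xi (co _ N i) t)%:E).
  by apply/funext => t; rewrite /r coE.
rewrite rE; split; first exact: integrable_lincomb.
apply: (integral_orthogonal xiP (M := co _ M) (b := fun j => b j 0)).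
  by move=> t j; rewrite mxE coE.
move=> j; have := congr1 (fun A : 'M[R]_(k, p) => A j i) MN.
rewrite summxE [RHS]mxE; apply: etrans; rewrite /co.
under eq_bigr do rewrite mulr_suml.
rewrite exchange_big/=; apply: eq_bigr => s _.
(* In the second factor only the block [s] matters: the other blocks are orthogonal to it by
   [a0]. *)
transitivity (\sum_x (\sum_l M s j l * a s l x) * (\sum_l N s i l * a s l x)).
  apply/eqP; rewrite -subr_eq0 -sumrB.
  under eq_bigr do rewrite -mulrBr (bigD1 s)//= addrAC subrr add0r mulr_sumr.
  rewrite exchange_big/= big1// => s' ss'.
  under eq_bigr do rewrite mulr_suml.
  rewrite exchange_big/= big1// => l _.
  under eq_bigr do rewrite mulr_sumr.
  rewrite exchange_big/= big1// => l' _.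
  under eq_bigr do rewrite mulrACA.
  by rewrite -mulr_sumr a0 ?mulr0// eq_sym.
rewrite !mxE.
under eq_bigr do rewrite mulr_sumr.
rewrite exchange_big/=; apply: eq_bigr => l' _.
rewrite !mxE mulr_suml.
under eq_bigr do rewrite mulr_suml.
rewrite exchange_big/=; apply: eq_bigr => l _.
under eq_bigr do rewrite mulrACA.
by rewrite -mulr_sumr aS mulrAC.
Qed.

End gaussian_family.

(** * Quadratic forms and the spectral clustering matrices *)

Section quadratic_form.
Context (R : realType).

Definition qf (m : nat) (M : 'M[R]_m) (x : 'cV[R]_m) : R := (x^T *m M *m x) 0 0.

(** Positivity alone; symmetry is a separate hypothesis where it is used. *)
Definition posdef (m : nat) (M : 'M[R]_m) := forall x : 'cV[R]_m, x != 0 -> 0 < qf M x.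

Definition possemidef (m : nat) (M : 'M[R]_m) := forall x : 'cV[R]_m, 0 <= qf M x.

Lemma bilin_tr (m : nat) (M : 'M[R]_m) (x y : 'cV[R]_m) : M^T = M ->
  (x^T *m M *m y) 0 0 = (y^T *m M *m x) 0 0.
Proof.
move=> Msym; have -> : y^T *m M *m x = (x^T *m M *m y)^T.
  by rewrite !trmx_mul trmxK Msym mulmxA.
by rewrite [RHS]mxE.
Qed.

Lemma qfD (m : nat) (M : 'M[R]_m) (x y : 'cV[R]_m) : M^T = M ->
  qf M (x + y) = qf M x + 2 * (x^T *m M *m y) 0 0 + qf M y.
Proof.
move=> Msym; rewrite /qf [(x + y)^T]linearD/= !mulmxDl !mulmxDr.
have := bilin_tr x y Msym.
move: (x^T *m M *m x) (x^T *m M *m y) (y^T *m M *m x) (y^T *m M *m y).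
by move=> a b c e bc; rewrite !mxE -bc; ring.
Qed.

Lemma qfZ (m : nat) (M : 'M[R]_m) c (x : 'cV[R]_m) : qf M (c *: x) = c ^+ 2 * qf M x.
Proof. by rewrite /qf [(c *: x)^T]linearZ/= -!scalemxAl -scalemxAr scalerA mxE expr2. Qed.

Lemma qfN (m : nat) (M : 'M[R]_m) (x : 'cV[R]_m) : qf M (- x) = qf M x.
Proof. by rewrite -scaleN1r qfZ sqrrN expr1n mul1r. Qed.

Lemma qf1_gt0 (m : nat) : posdef (1%:M : 'M[R]_m).
Proof.
move=> x x0; rewrite /qf mulmx1 mxE.
have [i xi] : exists i, x i 0 != 0.
  apply/existsP; rewrite -negb_forall; apply: contra x0 => /forallP h.
  by apply/eqP/colP => i; rewrite mxE; apply/eqP.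
rewrite (bigD1 i)//= mxE ltr_wpDr//; last first.
  by rewrite lt_neqAle eq_sym mulf_neq0//= -expr2 sqr_ge0.
by apply: sumr_ge0 => j _; rewrite mxE -expr2 sqr_ge0.
Qed.

Lemma posdef_semi (m : nat) (M : 'M[R]_m) : posdef M -> possemidef M.
Proof.
move=> pM x; have [->|/pM/ltW//] := eqVneq x 0.
by rewrite /qf mulmx0 mxE.
Qed.

Lemma posdef_eq0 (m : nat) (M : 'M[R]_m) x : posdef M -> qf M x <= 0 -> x = 0.
Proof. by move=> pM; have [//|/pM] := eqVneq x 0; rewrite ltNge => /negbTE ->. Qed.

Lemma posdefDsemi (m : nat) (M N : 'M[R]_m) : posdef M -> possemidef N -> posdef (M + N).
Proof.
by move=> pM pN x x0; rewrite /qf mulmxDr mulmxDl mxE ltr_pwDl ?pM ?pN.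
Qed.

Lemma possemidefZ (m : nat) c (M : 'M[R]_m) : 0 <= c -> possemidef M -> possemidef (c *: M).
Proof. by move=> c0 pM x; rewrite /qf -scalemxAr -scalemxAl mxE mulr_ge0// pM. Qed.

Lemma posdef_unitmx (m : nat) (M : 'M[R]_m) : posdef M -> M \in unitmx.
Proof.
move=> pM; rewrite -row_free_unit; apply: inj_row_free => v vM.
apply: trmx_inj; rewrite trmx0; apply: (posdef_eq0 pM).
by rewrite /qf trmxK vM mul0mx mxE.
Qed.

Lemma qf_congr (m k : nat) (M : 'M[R]_m) (B : 'M[R]_(k, m)) (x : 'cV[R]_k) :
  qf (B *m M *m B^T) x = qf M (B^T *m x).
Proof. by rewrite /qf trmx_mul trmxK !mulmxA. Qed.

Lemma posdef_congr (m k : nat) (M : 'M[R]_m) (B : 'M[R]_(k, m)) :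
  posdef M -> row_free B -> posdef (B *m M *m B^T).
Proof.
move=> pM fB x x0; rewrite qf_congr; apply: pM; apply: contra x0 => /eqP Bx.
apply/eqP/trmx_inj; rewrite trmx0; apply: (row_free_inj fB).
by rewrite mul0mx -[B]trmxK -trmx_mul Bx trmx0.
Qed.

Lemma possemidef_gram (m k : nat) (B : 'M[R]_(m, k)) : possemidef (B *m B^T).
Proof.
by move=> x; rewrite -[B in B *m _]mulmx1 qf_congr; exact/posdef_semi/qf1_gt0.
Qed.

Lemma posdef_inv (m : nat) (M : 'M[R]_m) : M^T = M -> posdef M -> posdef (invmx M).
Proof.
move=> Ms pM; have uM := posdef_unitmx pM.
have -> : invmx M = invmx M *m M *m (invmx M)^T.
  by rewrite mulVmx// mul1mx trmx_inv Ms.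
by apply: posdef_congr => //; rewrite row_free_unit unitmx_inv.
Qed.

Lemma posdef_diag (m : nat) (D : 'rV[R]_m) : (forall j, 0 < D 0 j) -> posdef (diag_mx D).
Proof.
move=> D0; pose S := diag_mx (\row_j Num.sqrt (D 0 j)).
have -> : diag_mx D = S *m 1%:M *m S^T.
  rewrite mulmx1 tr_diag_mx mulmx_diag; congr diag_mx; apply/rowP => j.
  by rewrite !mxE -expr2 sqr_sqrtr// ltW.
apply: posdef_congr; first exact: qf1_gt0.
rewrite row_free_unit unitmxE det_diag unitfE; apply/prodf_neq0 => j _.
by rewrite mxE gt_eqF// sqrtr_gt0.
Qed.

Lemma qf_mxdiag (C : nat) (n : 'I_C -> nat) (M : forall c, 'M[R]_(n c)) x :
  qf (\mxdiag_c M c) x = \sum_c qf (M c) (submxcol x c).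
Proof.
rewrite /qf -mulmxA -{2}[x]submxcolK mul_mxdiag_mxcol -{1}[x]submxcolK tr_mxcol.
rewrite mul_mxrow_mxcol summxE; apply: eq_bigr => c _.
by rewrite mulmxA.
Qed.

Lemma invmx_mxdiag (C : nat) (n : 'I_C -> nat) (M : forall c, 'M[R]_(n c))
    (x : forall c, 'cV[R]_(n c)) :
  (forall c, M c \in unitmx) -> \mxdiag_c M c \in unitmx ->
  invmx (\mxdiag_c M c) *m (\mxcol_c x c) = \mxcol_c (invmx (M c) *m x c).
Proof.
move=> uM u; apply: (canLR (mulKmx u)).
by rewrite mul_mxdiag_mxcol; apply: eq_mxcol => c; rewrite mulmxA mulmxV// mul1mx.
Qed.

End quadratic_form.

(** * The Laplacians and the matrices A_rho *)

Section spectral_matrices.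
Context (R : realType).

Lemma ones_mulE k (x : 'cV[R]_k) : @ones R k *m (@ones R k)^T *m x = (\sum_j x j 0) *: ones.
Proof.
apply/colP => i; rewrite -mulmxA !mxE big_ord1 !mxE mul1r mulr1.
by apply: eq_bigr => j _; rewrite !mxE mul1r.
Qed.

Lemma L_cluster_sym k : (L_cluster k : 'M[R]_k)^T = L_cluster k.
Proof. by rewrite /L_cluster linearB/= linearZ/= trmx1 trmx_mul trmxK. Qed.

Lemma L_cluster_sqr k : L_cluster k *m L_cluster k = k%:R *: (L_cluster k : 'M[R]_k).
Proof.
rewrite {1}/L_cluster mulmxBl -scalemxAl mul1mx.
suff -> : @ones R k *m (@ones R k)^T *m L_cluster k = 0 :> 'M[R]_k by rewrite subr0.
rewrite /L_cluster mulmxBr -scalemxAr mulmx1 mulmxA.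
have -> : @ones R k *m (@ones R k)^T *m @ones R k = k%:R *: ones :> 'cV[R]_k.
  rewrite ones_mulE; congr (_ *: _); under eq_bigr do rewrite mxE.
  by rewrite sumr_const card_ord.
by rewrite -scalemxAl subrr.
Qed.

Lemma L_cluster_psd k : possemidef (L_cluster k : 'M[R]_k).
Proof.
case: k => [|k]; first by move=> x; rewrite /qf [x]flatmx0 mulmx0 mxE.
have -> : (L_cluster k.+1 : 'M[R]_k.+1) =
    (k.+1)%:R^-1 *: (L_cluster k.+1 *m (L_cluster k.+1)^T).
  by rewrite L_cluster_sym L_cluster_sqr scalerA mulVf ?scale1r// pnatr_eq0.
by apply: possemidefZ; [rewrite invr_ge0|exact: possemidef_gram].
Qed.

Lemma L_SC_sym C (n : 'I_C -> nat) : (L_SC n : 'M[R]__)^T = L_SC n.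
Proof. by rewrite /L_SC tr_mxdiag; apply: eq_mxdiag => c; rewrite L_cluster_sym. Qed.

Lemma L_SC_psd C (n : 'I_C -> nat) : possemidef (L_SC n : 'M[R]__).
Proof. by move=> x; rewrite qf_mxdiag sumr_ge0// => c _; exact: L_cluster_psd. Qed.

Section weight.
Context (rho : R) (hrho : 0 < rho <= 1).

Let kap0 : 0 <= (1 - rho) / rho.
Proof. by case/andP: hrho => r0 r1; rewrite divr_ge0 ?subr_ge0// ltW. Qed.

Lemma A_cluster_sym k : (A_cluster k rho)^T = A_cluster k rho.
Proof. by rewrite /A_cluster linearD/= linearZ/= trmx1 L_cluster_sym. Qed.

Lemma A_cluster_pd k : posdef (A_cluster k rho).
Proof.
apply: posdefDsemi; [exact: qf1_gt0|apply: possemidefZ => //].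
exact: L_cluster_psd.
Qed.

Lemma A_SC_sym C (n : 'I_C -> nat) : (A_SC n rho)^T = A_SC n rho.
Proof. by rewrite /A_SC linearD/= linearZ/= trmx1 L_SC_sym. Qed.

Lemma A_SC_pd C (n : 'I_C -> nat) : posdef (A_SC n rho).
Proof.
apply: posdefDsemi; [exact: qf1_gt0|apply: possemidefZ => //].
exact: L_SC_psd.
Qed.

Lemma A_SCE C (n : 'I_C -> nat) : A_SC n rho = \mxdiag_c A_cluster (n c) rho.
Proof.
(* The identity is cut into block rows, so that the block diagonal matrices act on each block
   separately. *)
rewrite -[LHS]mulmx1 -[RHS]mulmx1 -(submxcolK 1%:M) mul_mxdiag_mxcol.
rewrite /A_SC mulmxDl mul1mx -scalemxAl mul_mxdiag_mxcol.
apply/matrixP => i j; rewrite [RHS]mxE /A_cluster mulmxDl mul1mx -scalemxAl.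
rewrite [LHS]mxE [RHS]mxE; congr (_ + _); first by rewrite mxE.
by rewrite [LHS]mxE [X in _ * X]mxE [RHS]mxE.
Qed.

Lemma invmx_A_SC C (n : 'I_C -> nat) (x : forall c, 'cV[R]_(n c)) :
  invmx (A_SC n rho) *m \mxcol_c x c = \mxcol_c (invmx (A_cluster (n c) rho) *m x c).
Proof.
have u := posdef_unitmx (@A_SC_pd C n); rewrite A_SCE in u *.
by apply: invmx_mxdiag => // c; exact/posdef_unitmx/A_cluster_pd.
Qed.

(** A fixes [ones] and multiplies vectors of zero sum by 1 + (1 - rho) k / rho, which is 1 / [gam].
    So A^-1 keeps the mean and contracts the deviations by [gam]. *)
Lemma invmx_A_cluster k (x : 'cV[R]_k) : (0 < k)%N ->
  invmx (A_cluster k rho) *m x =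
  gam k rho *: x + ((1 - gam k rho) * avg (fun j => x j 0)) *: ones.
Proof.
move=> k0; have /andP[r0 r1] := hrho.
apply: (canLR (mulKmx (posdef_unitmx (@A_cluster_pd k)))).
have kR : 0 < k%:R :> R by rewrite ltr0n.
set s := avg _; have sE : \sum_j x j 0 = k%:R * s.
  by rewrite /s /avg mulrA mulfV ?mul1r// gt_eqF.
have dn : (1 - rho) * k%:R + rho != 0.
  by rewrite gt_eqF// ltr_wpDl// mulr_ge0// ?subr_ge0// ltW.
rewrite /A_cluster /L_cluster mulmxDl mul1mx -scalemxAl mulmxBl -scalemxAl mul1mx.
rewrite ones_mulE; apply/colP => i; rewrite !mxE.
under eq_bigr do rewrite !mxE mulr1.
rewrite big_split/= -mulr_sumr sE sumr_const card_ord -mulr_natl /gam.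
by field; rewrite dn gt_eqF.
Qed.

(** With [a_denE], this identifies a_{rho,c} as A^-1 w^T / (w A^-1 w^T), the benchmarking correction
    for the single row w. *)
Lemma a_numE k (w : 'rV[R]_k) : (0 < k)%N ->
  a_num rho w = invmx (A_cluster k rho) *m w^T.
Proof.
move=> k0; rewrite invmx_A_cluster// /a_num; congr (_ + (_ * avg _) *: _).
by apply/funext => j; rewrite mxE.
Qed.

Lemma a_denE k (w : 'rV[R]_k) : (0 < k)%N -> (w *m a_num rho w) 0 0 = a_den rho w.
Proof.
move=> k0; have kR : k%:R != 0 :> R by rewrite pnatr_eq0 -lt0n.
rewrite /a_num /a_den mulmxDr -!scalemxAr !mxE; congr (_ * _ + _).
  by apply: eq_bigr => j _; rewrite mxE expr2.
have -> : \sum_j w 0 j * (ones : 'cV[R]_k) j 0 = k%:R * avg (w 0).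
  by rewrite /avg mulrA mulfV// mul1r; apply: eq_bigr => j _; rewrite mxE mulr1.
by rewrite expr2; ring.
Qed.

End weight.

End spectral_matrices.

(** * Projections and the penalised objective *)

Section constrained_minimisation.
Context (R : realType).

Lemma is_argmin_congr (T : Type) (F : set T) (f g : T -> R) :
  (forall v v', (f v <= f v') = (g v <= g v')) ->
  forall v, is_argmin F f v <-> is_argmin F g v.
Proof.
by move=> fg v; split=> -[Fv h]; split=> // v' /h; rewrite ?fg// -fg.
Qed.

Lemma winnerZr m (S : 'M[R]_m) x t y : winner S x (t *: y) = t * winner S x y.
Proof. by rewrite /winner -scalemxAr mxE. Qed.

Context (m k : nat) (A : 'M[R]_m) (Asym : A^T = A) (Apd : posdef A).
Context (W : 'M[R]_(k, m)) (p : 'cV[R]_k).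

Let Au : A \in unitmx. Proof. exact: posdef_unitmx. Qed.

Let winnerE x y : (x^T *m A *m y) 0 0 = winner (invmx A) x y.
Proof. by rewrite /winner invmxK. Qed.

Lemma wnorm_inv_le x y : (wnorm (invmx A) x <= wnorm (invmx A) y) = (qf A x <= qf A y).
Proof.
by rewrite /wnorm /winner invmxK ler_sqrt//; exact: posdef_semi.
Qed.

Lemma argmin_wprojP (mu v : 'cV[R]_m) :
  is_argmin (benchmark_set W p) (fun v => wnorm (invmx A) (mu - v)) v <->
  is_wproj (invmx A) (benchmark_set W p) mu v.
Proof.
have split2 z y : qf A (mu - y) =
    qf A (mu - z) - 2 * winner (invmx A) (mu - z) (y - z) + qf A (y - z).
  rewrite (_ : mu - y = (mu - z) + - (y - z)); last by rewrite opprB addrA subrK.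
  by rewrite qfD// winnerE qfN -[- (y - z)]scaleN1r winnerZr; ring.
split=> -[Fv h]; split=> // y Fy; last first.
  rewrite wnorm_inv_le (split2 v y) h// mulr0 subr0 lerDl.
  exact: posdef_semi.
set b := winner _ _ _; set c := qf A (y - v).
have c0 : 0 <= c by exact: posdef_semi.
have key t : 0 <= - (2 * (t * b)) + t ^+ 2 * c.
  have Fz : benchmark_set W p (v + t *: (y - v)).
    rewrite /benchmark_set/= mulmxDr -scalemxAr mulmxBr.
    by rewrite (Fv : W *m v = p) (Fy : W *m y = p) subrr scaler0 addr0.
  have := h _ Fz; rewrite wnorm_inv_le (split2 v (v + t *: (y - v))).
  by rewrite [v + _]addrC addrK qfZ -/c winnerZr -/b; lra.
(* The optimal step would be b / c, but c vanishes when y = v; c + 1 avoids the division by zero and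
   still leaves a negative multiple of b^2. *)
have := key (b / (c + 1)).
have c1 : 0 < c + 1 by rewrite ltr_wpDl.
have -> : - (2 * (b / (c + 1) * b)) + (b / (c + 1)) ^+ 2 * c
    = - (b ^+ 2 * ((c + 2) / (c + 1) ^+ 2)).
  by field; rewrite gt_eqF.
rewrite oppr_ge0 pmulr_lle0; last by rewrite divr_gt0 ?exprn_gt0// ltr_wpDl.
by move=> b2; apply/eqP; rewrite -sqrf_eq0 eq_le b2 sqr_ge0.
Qed.

Hypothesis Wfree : row_free W.

Lemma benchmark_unit : W *m invmx A *m W^T \in unitmx.
Proof. by apply: posdef_unitmx; apply: posdef_congr => //; exact: posdef_inv. Qed.

Lemma benchmarked_in (mu : 'cV[R]_m) : W *m benchmarked A W p mu = p.
Proof.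
rewrite /benchmarked mulmxDr !mulmxA mulmxV ?benchmark_unit// mul1mx.
by rewrite addrC subrK.
Qed.

(** The correction lies in the range of A^-1 W^T, which is orthogonal to the kernel of W for the
    inner product x^T A y. *)
Lemma benchmarked_wproj (mu : 'cV[R]_m) :
  is_wproj (invmx A) (benchmark_set W p) mu (benchmarked A W p mu).
Proof.
have Fb := benchmarked_in mu; split=> // v Fv; rewrite -winnerE.
pose q := invmx (W *m invmx A *m W^T) *m (p - W *m mu).
have -> : mu - benchmarked A W p mu = - (invmx A *m (W^T *m q)).
  by rewrite /benchmarked opprD addrA subrr add0r /q !mulmxA.
rewrite [(- _)^T]linearN/= trmx_mul trmx_inv Asym trmx_mul trmxK !mulNmx.
rewrite mulmxKV// -mulmxA. rewrite mulmxBr.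
by rewrite (Fv : W *m v = p) Fb subrr !mulmx0 oppr0 mxE.
Qed.

Lemma argmin_benchmarked (mu v : 'cV[R]_m) :
  is_argmin (benchmark_set W p) (fun v => wnorm (invmx A) (mu - v)) v <->
  v = benchmarked A W p mu.
Proof.
have bP := benchmarked_wproj mu; set b := benchmarked A W p mu in bP *.
rewrite argmin_wprojP; split=> [[Fv vP]|->//].
(* Uniqueness: the orthogonality relations of the two projections [v] and [b], each tested against
   the other, combine to [qf A (v - b) = 0]. *)
have := vP b bP.1; have := bP.2 v Fv.
rewrite -[b - v]opprB -[- (v - b)]scaleN1r winnerZr -!winnerE.
have -> : mu - b = (mu - v) + (v - b) by rewrite addrA subrK.
rewrite [(_ + (v - b))^T]linearD/= !mulmxDl [in X in X -> _]mxE.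
rewrite -/(qf A (v - b)) => h1 h2.
apply/eqP; rewrite -subr_eq0; apply/eqP/(posdef_eq0 Apd).
by move: h1 h2; lra.
Qed.

End constrained_minimisation.

Section spectral_objective.
Context (R : realType) (C : nat) (n : 'I_C -> nat) (rho : R) (hrho : 0 < rho <= 1).
Local Notation m := (\sum_(c < C) n c)%N.
Local Notation A := (A_SC n rho).

Let r0 : rho != 0. Proof. by rewrite gt_eqF//; case/andP: hrho. Qed.

Lemma SC_objectiveE (theta : 'cV[R]_m) v : SC_objective rho theta v =
  rho * (qf A (v - invmx A *m theta)
         + ((theta^T *m theta) 0 0 - qf (invmx A) theta)).
Proof.
have As := A_SC_sym rho n; have Au := posdef_unitmx (@A_SC_pd _ _ hrho _ n).
have Ai : (invmx A)^T = invmx A by rewrite trmx_inv As.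
rewrite qfD// qfN.
have -> : qf A (invmx A *m theta) = qf (invmx A) theta.
  by rewrite /qf trmx_mul Ai -!mulmxA mulKVmx.
have -> : (v^T *m A *m - (invmx A *m theta)) 0 0 = - (v^T *m theta) 0 0.
  by rewrite mulmxN -!mulmxA mulKVmx// mxE.
have -> : qf A v = (v^T *m v) 0 0 + (1 - rho) / rho * qf (L_SC n) v.
  by rewrite /qf /A_SC mulmxDr mulmx1 mulmxDl -scalemxAr -scalemxAl mxE [X in _ + X]mxE.
have -> : SC_objective rho theta v = rho * ((v^T *m v) 0 0 - 2 * (v^T *m theta) 0 0
    + (theta^T *m theta) 0 0) + (1 - rho) * qf (L_SC n) v.
  rewrite /SC_objective; congr (rho * _ + _).
  have oppE (M : 'M[R]_1) : (- M) 0 0 = - M 0 0 by rewrite mxE.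
  have := @qfD R _ 1%:M v (- theta) (trmx1 _ _).
  by rewrite qfN /qf !mulmx1 mulmxN oppE => ->; ring.
by field.
Qed.

Lemma SC_objective_le (theta v v' : 'cV[R]_m) :
  (SC_objective rho theta v <= SC_objective rho theta v') =
  (wnorm (invmx A) (invmx A *m theta - v) <= wnorm (invmx A) (invmx A *m theta - v')).
Proof.
rewrite wnorm_inv_le; last exact: A_SC_pd.
rewrite !SC_objectiveE ler_pM2l; last by case/andP: hrho.
by rewrite lerD2r -!(qfN _ (_ - invmx _ *m _)) !opprB.
Qed.

Lemma SC_objective_convex (theta : 'cV[R]_m) :
  convex_function [set: 'cV[R]_m] (SC_objective rho theta).
Proof.
move=> t x y _ _.
have t0 : 0 <= t%:num by []. have t1 : t%:num <= 1 by [].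
suff : SC_objective rho theta (t%:num *: (x : 'cV[R]_m) + (1 - t%:num) *: (y : 'cV[R]_m))
  <= t%:num * SC_objective rho theta x + (1 - t%:num) * SC_objective rho theta y.
  exact.
move: (x : 'cV[R]_m) (y : 'cV[R]_m) => {}x {}y.
rewrite !SC_objectiveE; set mu := invmx A *m theta.
have -> : t%:num *: x + (1 - t%:num) *: y - mu = (y - mu) + t%:num *: (x - y).
  by apply/colP => i; rewrite !mxE; ring.
have -> : x - mu = (y - mu) + (x - y) by apply/colP => i; rewrite !mxE; ring.
have As := A_SC_sym rho n.
move: (y - mu) (x - y) => a z; rewrite !qfD// qfZ -scalemxAr.
have -> (M : 'M[R]_1) : (t%:num *: M) 0 0 = t%:num * M 0 0 by rewrite mxE.
have := posdef_semi (@A_SC_pd _ _ hrho _ n) z.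
set q := qf A z; set w := (_ *m _ *m _) 0 0; set q' := qf A a.
set k := (theta^T *m theta) 0 0 - _ => q0.
have /andP[rh0 _] := hrho; set s := t%:num in t0 t1 *.
rewrite -subr_ge0.
(* The convexity gap of a quadratic function is an exact multiple of the quadratic form at x - y. *)
rewrite [X in 0 <= X](_ : _ = rho * (s * (1 - s) * q)); last by ring.
by rewrite !mulr_ge0 ?subr_ge0// ltW.
Qed.

Lemma SC_objective_differentiable (theta v : 'cV[R]_m) :
  differentiable (SC_objective rho theta) v.
Proof.
have dc (i : 'I_m) : differentiable (fun v : 'cV[R]_m => v i 0) v.
  exact: differentiable_coord.
(* A polynomial in the coordinates, written with sums of functions rather than sums of values, as
   [differentiable_sum] expects. *)
have -> : SC_objective rho theta = (fun v : 'cV[R]_m =>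
   rho * (\sum_i (fun v : 'cV[R]_m => (v i 0 - theta i 0) * (v i 0 - theta i 0))) v +
   (1 - rho) * (\sum_i (\sum_j (fun v : 'cV[R]_m => v j 0 * L_SC n j i * v i 0))) v).
  apply/funext => w; rewrite /SC_objective; congr (_ * _ + _ * _).
    by rewrite mxE fct_sumE; apply: eq_bigr => i _; rewrite !mxE.
  rewrite mxE fct_sumE; apply: eq_bigr => i _.
  by rewrite !mxE fct_sumE mulr_suml; apply: eq_bigr => j _; rewrite !mxE.
apply: differentiableD; apply: differentiableM => //.
- apply: differentiable_sum => i; apply: differentiableM; exact: differentiableB.
- apply: differentiable_sum => i; apply: differentiable_sum => j.
  by apply: differentiableM => //; apply: differentiableM.
Qed.

End spectral_objective.

(** * Block formulas *)

Section block_benchmark.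
Context (R : realType) (C : nat) (n : 'I_C -> nat) (hn : forall c, (0 < n c)%N).
Context (rho : R) (hrho : 0 < rho <= 1) (w : forall c, 'rV[R]_(n c)).
Local Notation A := (A_SC n rho).

(** Replaces the computation of an inverse Gram matrix by the verification of a guessed solution
    [z]. *)
Let benchmark_solve (k : nat) (W : 'M[R]_(k, \sum_(c < C) n c)) (r z : 'cV[R]_k) :
  row_free W -> W *m invmx A *m W^T *m z = r ->
  invmx (W *m invmx A *m W^T) *m r = z.
Proof.
move=> Wf <-; rewrite mulKmx//; apply: benchmark_unit => //.
- exact: A_SC_sym.
- exact: A_SC_pd.
Qed.

Lemma cluster_W_mul (x : 'cV[R]_(\sum_(c < C) n c)) :
  cluster_W w *m x = \col_c (w c *m submxcol x c) 0 0.
Proof.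
apply/colP => c; rewrite [RHS]mxE.
transitivity ((row c (cluster_W w) *m x) 0 0); first by rewrite -row_mul [RHS]mxE.
rewrite /cluster_W rowK -{1}[x]submxcolK mul_mxrow_mxcol summxE (bigD1 c)//=.
rewrite eqxx mulr1n big1 ?addr0// => c' /negbTE cc'.
by rewrite cc' mulr0n mul0mx mxE.
Qed.

Lemma cluster_W_tr_mul (z : 'cV[R]_C) :
  (cluster_W w)^T *m z = \mxcol_c (z c 0 *: (w c)^T).
Proof.
apply/colP => i; rewrite mxE [RHS]mxE (bigD1 (tagnat.sig1 i))//=.
rewrite [X in _ + X]big1 => [|c ci].
  by rewrite [LHS]addr0 !mxE eqxx mulr1n mulrC.
by rewrite !mxE eq_sym (negbTE ci) mulr0n mxE mul0r.
Qed.

(** Row c of the constraints touches cluster c only and A^-1 is block diagonal, so the Gram matrix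
    is diagonal. *)
Lemma cluster_W_gram (z : 'cV[R]_C) :
  cluster_W w *m invmx A *m (cluster_W w)^T *m z =
  \col_c (z c 0 * a_den rho (w c)).
Proof.
rewrite -mulmxA cluster_W_tr_mul -mulmxA invmx_A_SC// cluster_W_mul.
apply/colP => c; rewrite [LHS]mxE [RHS]mxE mxcolK -!scalemxAr -a_numE//.
by rewrite [LHS]mxE a_denE.
Qed.

(** A zero on the diagonal would make the invertible Gram matrix kill a basis vector. *)
Lemma a_den_cluster_neq0 c : row_free (cluster_W w) -> a_den rho (w c) != 0.
Proof.
move=> Wf; apply/eqP => a0.
have := benchmark_solve Wf (cluster_W_gram (delta_mx c 0)).
have -> : \col_c' ((delta_mx c 0 : 'cV[R]_C) c' 0 * a_den rho (w c')) = 0.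
  by apply/colP => c'; rewrite !mxE; case: eqVneq => [->|_]; rewrite ?a0 ?mulr0 ?mul0r.
rewrite mulmx0 => /(congr1 (fun M : 'cV[R]_C => M c 0)).
by rewrite !mxE !eqxx => /esym/eqP; rewrite oner_eq0.
Qed.

Lemma cluster_benchmarkedE (p : 'cV[R]_C) x c : row_free (cluster_W w) ->
  submxcol (benchmarked A (cluster_W w) p x) c =
  submxcol x c + ((a_den rho (w c))^-1 * (p c 0 - (w c *m submxcol x c) 0 0))
                   *: a_num rho (w c).
Proof.
move=> Wf; set r := p - cluster_W w *m x.
pose z := \col_c ((a_den rho (w c))^-1 * r c 0).
rewrite /benchmarked -/r submxcolD; congr (_ + _).
rewrite -mulmxA (benchmark_solve Wf (z := z)); last first.
  rewrite cluster_W_gram; apply/colP => c'; rewrite !mxE.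
  by rewrite mulrAC mulVf ?mul1r// a_den_cluster_neq0.
rewrite -mulmxA cluster_W_tr_mul invmx_A_SC// mxcolK -scalemxAr -a_numE//.
rewrite [z c 0]mxE; congr (_ * _ *: _).
by rewrite /r cluster_W_mul !mxE.
Qed.

Lemma single_W_gram (z : 'cV[R]_1) :
  \mxrow_c w c *m invmx A *m (\mxrow_c w c)^T *m z =
  (\sum_c a_den rho (w c)) *: z.
Proof.
rewrite tr_mxrow -2!mulmxA mxcol_mul invmx_A_SC// mul_mxrow_mxcol.
rewrite scaler_suml; apply: eq_bigr => c _.
by rewrite !mulmxA -(mulmxA (w c)) -a_numE// [w c *m _]mx11_scalar a_denE// mul_scalar_mx.
Qed.

Lemma a_den_sum_neq0 : row_free (\mxrow_c w c) -> \sum_c a_den rho (w c) != 0.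
Proof.
move=> Wf; apply/eqP => a0; have := benchmark_solve Wf (single_W_gram 1%:M).
rewrite a0 scale0r mulmx0 => /(congr1 (fun M : 'cV[R]_1 => M 0 0)).
by rewrite !mxE => /esym/eqP; rewrite oner_eq0.
Qed.

(** One constraint couples the clusters: its Gram matrix is the scalar sum of all [a_den], and the
    discrepancy is that of the total. Only the direction [a_num] stays local. *)
Lemma single_benchmarkedE (p : R) x c : row_free (\mxrow_c w c) ->
  submxcol (benchmarked A (\mxrow_c w c) p%:M x) c =
  submxcol x c + ((\sum_c a_den rho (w c))^-1 *
                  (p - \sum_c (w c *m submxcol x c) 0 0)) *: a_num rho (w c).
Proof.
move=> Wf; set s := \sum_c a_den rho (w c).
pose r := p%:M - \mxrow_c w c *m x.
rewrite /benchmarked -/r submxcolD; congr (_ + _).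
rewrite -mulmxA (benchmark_solve Wf (z := s^-1 *: r)); last first.
  by rewrite single_W_gram -/s scalerA mulfV ?scale1r// a_den_sum_neq0.
have rE : r = (p - \sum_c (w c *m submxcol x c) 0 0)%:M.
  rewrite [LHS]mx11_scalar /r -{1}[x]submxcolK mul_mxrow_mxcol.
  by congr (_%:M); rewrite !mxE summxE eqxx mulr1n.
rewrite tr_mxrow -mulmxA mxcol_mul invmx_A_SC// mxcolK mulmxA -a_numE//.
by rewrite rE scale_scalar_mx mul_mx_scalar.
Qed.

End block_benchmark.

(** * The posterior residual within one cluster *)

Section posterior_residual.
Context (R : realType) (k s q : nat) (rho : R) (hrho : 0 < rho <= 1).
Context (k0 : (0 < k)%N) (Dv : 'rV[R]_k) (hD : forall j, 0 < Dv 0 j).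
Context (X : 'M[R]_(k, s)) (delta : 'cV[R]_s) (Z : 'M[R]_(k, q)).
Context (r : nat) (S : 'M[R]_(q, r)).
Local Notation D := (diag_mx Dv).
Local Notation G := (S *m S^T).
Local Notation A := (A_cluster k rho).
Hypothesis hG : Z *m G *m Z^T \in unitmx.

Let As : A^T = A. Proof. exact: A_cluster_sym. Qed.
Let Ap : posdef A. Proof. exact: A_cluster_pd. Qed.
Let Au : A \in unitmx. Proof. exact: posdef_unitmx. Qed.
Let Ds : D^T = D. Proof. exact: tr_diag_mx. Qed.
Let Dp : posdef D. Proof. exact: posdef_diag. Qed.
Let Du : D \in unitmx. Proof. exact: posdef_unitmx. Qed.
Let Gs : G^T = G. Proof. by rewrite trmx_mul trmxK. Qed.
Let Qs : (Z *m G *m Z^T)^T = Z *m G *m Z^T.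
Proof. by rewrite trmx_mul trmxK trmx_mul Gs mulmxA. Qed.

(** Invertibility of the Gram matrix of [Z *m S] forces the rows of [Z *m S] to be independent,
    hence positive definiteness. This is why the section works with a factor [S] of [G]. *)
Let Qp : posdef (Z *m G *m Z^T).
Proof.
have QE : Z *m G *m Z^T = (Z *m S) *m 1%:M *m (Z *m S)^T.
  by rewrite mulmx1 trmx_mul !mulmxA.
rewrite QE; apply: posdef_congr; first exact: qf1_gt0.
apply: inj_row_free => v vB.
have : v *m (Z *m G *m Z^T) = 0 by rewrite QE mulmx1 mulmxA vB mul0mx.
by move=> /(congr1 (mulmx^~ (invmx (Z *m G *m Z^T)))); rewrite mulmxK// mul0mx.
Qed.

Let ADAE : invmx (A *m D *m A^T) = invmx A *m invmx D *m invmx A.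
Proof.
have uAD : A *m D *m A^T \in unitmx by rewrite !unitmx_mul As Au Du.
have e : A *m D *m A^T *m (invmx A *m invmx D *m invmx A) = 1%:M.
  by rewrite As !mulmxA (mulmxK Au) (mulmxK Du) mulmxV.
by rewrite -[RHS](mulKmx uAD) e mulmx1.
Qed.

Local Notation V := (post_var rho D Z G).
Local Notation Q := (Z *m G *m Z^T).

Let prec := invmx (A *m D *m A^T) + invmx Q.

Let precu : prec \in unitmx.
Proof.
apply: posdef_unitmx; apply: posdefDsemi; last first.
  by apply/posdef_semi/posdef_inv.
apply: posdef_inv; first by rewrite !trmx_mul trmxK Ds As mulmxA.
by apply: posdef_congr => //; rewrite row_free_unit.
Qed.

Let Vs : V^T = V.
Proof.
rewrite /post_var trmx_inv linearD/= !trmx_inv Qs.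
by rewrite !trmx_mul trmxK Ds As mulmxA.
Qed.

Lemma post_mean_FHSCE y : post_mean_FHSC rho D X delta Z G y =
  invmx A *m V *m (invmx Q *m (X *m delta))
  + invmx A *m V *m invmx A *m invmx D *m y.
Proof.
rewrite /post_mean_FHSC -invmx_A_cluster// /post_mean -mulmxA.
by rewrite [in LHS]addrC !mulmxDr !mulmxA.
Qed.

Definition resid_e : 'M[R]_k := - (invmx A *m V *m invmx A *m invmx D).
Definition resid_u : 'M[R]_(k, q) := invmx A *m V *m invmx Q *m Z.

Lemma post_residualE e u :
  let theta := invmx A *m (X *m delta + Z *m u) in
  theta - post_mean_FHSC rho D X delta Z G (theta + e) =
  resid_e *m e + resid_u *m u.
Proof.
set m := X *m delta; set th := m + Z *m u => /=.
rewrite post_mean_FHSCE -/m.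
(* With th written as V applied to the precision times th, the terms in X delta and in A^-1 D^-1
   A^-1 th cancel against the posterior mean. The second cancellation dictates the order A^-1 D^-1
   in front of y. *)
have VS : V *m (prec *m th) = th by rewrite mulKmx.
rewrite -{1}VS /prec ADAE !mulmxDl !mulmxDr /resid_e /resid_u !mulmxA !mulNmx.
have aux (a b c f g : 'cV[R]_k) : a + b + (c + f) - (c + (a + b + g)) = - g + f.
  by apply/colP => i; rewrite !mxE; ring.
exact: aux.
Qed.

(** The covariance of y with the residual: the errors contribute - A^-1 V A^-1, and the random
    effects A^-1 Q Q^-1 V A^-1, its opposite. *)
Lemma resid_uncorrelated :
  D *m resid_e^T + invmx A *m Z *m G *m resid_u^T = 0.
Proof.
have Ais : (invmx A)^T = invmx A by rewrite trmx_inv As.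
rewrite /resid_e /resid_u linearN/= !trmx_mul Vs !trmx_inv Ds As -/Q Qs.
rewrite mulmxN !mulmxA mulmxV// mul1mx.
have -> : invmx A *m Z *m S *m S^T *m Z^T = invmx A *m Q by rewrite !mulmxA.
have -> : Z *m S *m S^T *m Z^T = Q by rewrite !mulmxA.
by rewrite (mulmxK hG) addNr.
Qed.

End posterior_residual.

(** * The posterior mean of the FH-SC model *)

(** Serves to pass from all the data to [y_c], on which alone the posterior mean of cluster c
    depends. *)
Lemma is_condexp_sub d (T : measurableType d) (R : realType)
    (P : probability T R) (F F' : set (set T)) (k : nat) (X h : T -> 'cV[R]_k) :
  F' `<=` F ->
  (forall i (B : set R), measurable B -> F' ((fun t => h t i 0) @^-1` B)) ->
  is_condexp P F X h -> is_condexp P F' X h.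
Proof.
move=> F'F mh Xh i; have [iX ih _ XhE] := Xh i; split => //.
  exact: mh.
by move=> A /F'F; exact: XhE.
Qed.

Lemma submxcol_linE (R : pzRingType) (C : nat) (n : 'I_C -> nat) c
    (x : 'cV[R]_(\sum_(c < C) n c)) : submxcol x c = submxcol 1%:M c *m x.
Proof. by rewrite submxcol_mul mul1mx. Qed.

Lemma mxcol_sumE (R : pzRingType) (C : nat) (n : 'I_C -> nat)
    (x : forall c, 'cV[R]_(n c)) :
  \mxcol_c x c = \sum_c submxrow 1%:M c *m x c.
Proof. by rewrite -[LHS]mul1mx -{1}(submxrowK 1%:M) mul_mxrow_mxcol. Qed.

Lemma mxcol_Rank (R : Type) (C : nat) (n : 'I_C -> nat)
    (x : forall c, 'cV[R]_(n c)) c j :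
  (\mxcol_c x c) (tagnat.Rank c j) 0 = x c j 0.
Proof. by rewrite -(mxcolK x c) [RHS]mxE. Qed.

Lemma is_condexp_mxcolP d (T : measurableType d) (R : realType)
    (P : probability T R) (F : set (set T)) (C : nat) (n : 'I_C -> nat)
    (X h : forall c, T -> 'cV[R]_(n c)) :
  is_condexp P F (fun t => \mxcol_c X c t) (fun t => \mxcol_c h c t) <->
  forall c, is_condexp P F (X c) (h c).
Proof.
split=> [H c i|H i].
  have E (Y : forall c, T -> 'cV[R]_(n c)) :
      (fun t => (\mxcol_c Y c t) (tagnat.Rank c i) 0) = (fun t => Y c t i 0).
    by apply/funext => t; rewrite mxcol_Rank.
  have := H (tagnat.Rank c i); rewrite (E h).
  have EE (Y : forall c, T -> 'cV[R]_(n c)) :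
      (fun t => ((\mxcol_c Y c t) (tagnat.Rank c i) 0)%:E) =
      (fun t => (Y c t i 0)%:E) by apply/funext => t; rewrite mxcol_Rank.
  by rewrite (EE X) (EE h).
have E (Y : forall c, T -> 'cV[R]_(n c)) : (fun t => (\mxcol_c Y c t) i 0) =
    (fun t => Y (tagnat.sig1 i) t (tagnat.sig2 i) 0).
  by apply/funext => t; rewrite mxE.
have EE (Y : forall c, T -> 'cV[R]_(n c)) :
    (fun t => ((\mxcol_c Y c t) i 0)%:E) =
    (fun t => (Y (tagnat.sig1 i) t (tagnat.sig2 i) 0)%:E).
  by apply/funext => t; rewrite mxE.
by rewrite (EE X) (EE h) (E h); exact: H.
Qed.

Section FHSC_posterior.
Context (R : realType) (C : nat) (n : 'I_C -> nat) (hn : forall c, (0 < n c)%N).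
Context (rho : R) (hrho : 0 < rho <= 1) (s q : 'I_C -> nat).
Context (X : forall c, 'M[R]_(n c, s c)) (Z : forall c, 'M[R]_(n c, q c)).
Context (Dvar : forall c, 'rV[R]_(n c)) (hD : forall c j, 0 < Dvar c 0 j).
Context (delta : forall c, 'cV[R]_(s c)) (G : forall c, 'M[R]_(q c)).
Hypothesis hG : forall c, Z c *m G c *m (Z c)^T \in unitmx.
Context d (T : measurableType d) (P : probability T R).
Context (e : forall c, T -> 'cV[R]_(n c)) (u : forall c, T -> 'cV[R]_(q c)).
Hypothesis HP : FHSC_errors P (fun c => diag_mx (Dvar c)) G e u.

Local Notation K := ('I_C + 'I_C)%type.
Local Notation theta_c c := (FHSC_theta rho (X c) (delta c) (Z c) (u c)).
Local Notation y_c c := (FHSC_y rho (X c) (delta c) (Z c) (u c) (e c)).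
Local Notation E_c c := (post_mean_FHSC rho (diag_mx (Dvar c)) (X c) (delta c) (Z c) (G c)).
Local Notation y := (fun t => \mxcol_(c < C) y_c c t).
Local Notation Ai c := (invmx (A_cluster (n c) rho)).
Local Notation Emb c := (submxrow (1%:M : 'M[R]_(\sum_(c < C) n c)) c).

(** Errors and random effects form one family over the sum type, the index type of the independence
    in [FHSC_errors]. *)
Let dim (x : K) : nat := match x with inl c => n c | inr c => q c end.
Let noise (x : K) : T -> 'cV[R]_(dim x) :=
  match x return T -> 'cV[R]_(dim x) with inl c => e c | inr c => u c end.
Let Sig (x : K) : 'M[R]_(dim x) :=
  match x return 'M[R]_(dim x) with inl c => diag_mx (Dvar c) | inr c => G c end.

Let noiseN x : is_mvnormal P (noise x) 0 (Sig x).
Proof. by have [he hu _] := HP; case: x. Qed.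

Let noiseI : mutually_independent P (fun x => sigma_vec (noise x)).
Proof.
have [_ _] := HP; congr (mutually_independent P _).
by apply/funext => -[].
Qed.

Let combine (p : nat) (M : forall c, 'M[R]_(p, n c)) (N : forall c, 'M[R]_(p, q c))
    (x : K) : 'M[R]_(p, dim x) :=
  match x return 'M[R]_(p, dim x) with inl c => M c | inr c => N c end.

Let combineE p M N t : \sum_x combine M N x *m noise x t =
  \sum_c (M c *m e c t + N c *m u c t) :> 'cV[R]_p.
Proof. by rewrite big_sumType big_split. Qed.

Let My := combine (fun c => Emb c) (fun c => Emb c *m (Ai c *m Z c)).

Let yE : y = fun t => \mxcol_c (Ai c *m (X c *m delta c)) + \sum_x My x *m noise x t.
Proof.
apply/funext => t; rewrite combineE !mxcol_sumE -big_split/=; apply: eq_bigr => c _.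
rewrite /FHSC_y /FHSC_theta !mulmxDr !mulmxA -!addrA; congr (_ + _).
exact: addrC.
Qed.

Let integrable_noise p (N : forall x, 'M[R]_(p, dim x)) i :
  P.-integrable setT (fun t => ((\sum_x N x *m noise x t) i 0)%:E).
Proof.
(* Only integrability is wanted, so the data vector is taken of dimension 0. *)
have h := @gaussian_family_uncorrelated _ _ _ _ _ _ _ _ noiseN noiseI 0 p 0
  (fun x => 0) N.
have [|] // := h _ i.
by rewrite big1// => x _; rewrite !mul0mx.
Qed.

Let integrable_affine p b (N : forall x, 'M[R]_(p, dim x)) i :
  P.-integrable setT (fun t => ((b + \sum_x N x *m noise x t) i 0)%:E).
Proof.
under eq_fun do rewrite mxE EFinD.
apply: integrableD => //.
exact: (finite_measure_integrable_cst P (b i 0)).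
Qed.

Lemma sigma_vec_y_measurable : sigma_vec y `<=` measurable.
Proof.
rewrite yE; apply: sigma_vec_measurable => i.
by apply/measurable_EFinP; have /integrableP[] := integrable_affine
  (\mxcol_c (Ai c *m (X c *m delta c))) My i.
Qed.

Let y_cE c i t : y_c c t i 0 = y t (tagnat.Rank c i) 0.
Proof. by rewrite mxcol_Rank. Qed.

Lemma sigma_vec_y_cluster c : sigma_vec (y_c c) `<=` sigma_vec y.
Proof.
apply: sigma_vec_sub; first exact: sigma_algebra_sigma_vec.
move=> i B mB; have -> : (fun t => y_c c t i 0) = (fun t => y t (tagnat.Rank c i) 0).
  by apply/funext => t; rewrite y_cE.
exact: sigma_vec_coord.
Qed.

(** The factor is read off from the normality of [u c]. *)
Let Gfactor c : {r : nat & {S : 'M[R]_(q c, r) | G c = S *m S^T}}.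
Proof.
have [_ hu _] := HP; have /cid[r /cid[S /cid[xi [_ SG _ _ _]]]] := hu c.
by exists r, S.
Qed.

Lemma post_mean_measurable c i (B : set R) : measurable B ->
  sigma_vec (y_c c) ((fun t => E_c c (y_c c t) i 0) @^-1` B).
Proof.
have [r [S GS]] := Gfactor c.
have [b [M EM]] : exists b (M : 'M[R]_(n c)), forall z, E_c c z = b + M *m z.
  rewrite GS; eexists; eexists => z; apply: post_mean_FHSCE => //.
have -> : (fun t => E_c c (y_c c t) i 0) =
    (fun t => b i 0 + \sum_j M i j * y_c c t j 0).
  by apply/funext => t; rewrite EM !mxE.
apply: sub_measurable_affine; first exact: sigma_algebra_sigma_vec.
by move=> j A mA; exact: sigma_vec_coord.
Qed.

Lemma FHSC_condexp : is_condexp P (sigma_vec y)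
  (fun t => \mxcol_c theta_c c t) (fun t => \mxcol_c E_c c (y_c c t)).
Proof.
have resid c : exists (Re : 'M[R]_(n c)) (Ru : 'M[R]_(n c, q c)),
    (forall t, theta_c c t - E_c c (y_c c t) = Re *m e c t + Ru *m u c t) /\
    diag_mx (Dvar c) *m Re^T + Ai c *m Z c *m G c *m Ru^T = 0.
  have [r [S GS]] := Gfactor c; rewrite GS.
  have hGS : Z c *m (S *m S^T) *m (Z c)^T \in unitmx by rewrite -GS.
  eexists; eexists; split => [t|]; first by apply: post_residualE.
  exact: resid_uncorrelated.
pose Re c := projT1 (cid (resid c)).
pose Ru c : 'M[R]_(n c, q c) := projT1 (cid (projT2 (cid (resid c)))).
have ReuP c : (forall t, theta_c c t - E_c c (y_c c t) = Re c *m e c t + Ru c *m u c t) /\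
    diag_mx (Dvar c) *m (Re c)^T + Ai c *m Z c *m G c *m (Ru c)^T = 0.
  exact: projT2 (cid (projT2 (cid (resid c)))).
pose N := combine (fun c => Emb c *m Re c) (fun c => Emb c *m Ru c).
have NE t : (\mxcol_c theta_c c t) - (\mxcol_c E_c c (y_c c t)) =
    \sum_x N x *m noise x t.
  rewrite -mxcolB mxcol_sumE combineE; apply: eq_bigr => c _.
  by rewrite (ReuP c).1 mulmxDr !mulmxA.
(* Different clusters share no noise, so the covariance of the stacked vectors is a sum of embedded
   cluster terms, each zero by [resid_uncorrelated]. *)
have MN : \sum_x My x *m Sig x *m (N x)^T = 0.
  rewrite big_sumType/= -big_split/=; apply: big1 => c _.
  rewrite !trmx_mul -!mulmxA -mulmxDr !mulmxA -!mulmxDl.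
  have := (ReuP c).2; rewrite !mulmxA => ->.
  by rewrite mulmx0 mul0mx.
have Nr := gaussian_family_uncorrelated noiseN noiseI
  (\mxcol_c (Ai c *m (X c *m delta c))) MN.
apply: is_condexp_residual.
- exact: sigma_vec_y_measurable.
- move=> i.
  have tE : (fun t => \mxcol_c theta_c c t) =
      (fun t => \mxcol_c (Ai c *m (X c *m delta c)) +
        \sum_x combine (fun c => 0) (fun c => Emb c *m (Ai c *m Z c)) x *m noise x t).
    apply/funext => t; rewrite combineE !mxcol_sumE -big_split/=.
    apply: eq_bigr => c _.
    by rewrite mul0mx add0r /FHSC_theta !mulmxDr !mulmxA.
  have -> : (fun t => ((\mxcol_c theta_c c t) i 0)%:E) = (fun t =>
     ((\mxcol_c (Ai c *m (X c *m delta c)) +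
        \sum_x combine (fun c => 0) (fun c => Emb c *m (Ai c *m Z c)) x *m noise x t) i 0)%:E).
    by apply/funext => t; have /(congr1 (@^~ t)) -> := tE.
  exact: integrable_affine.
- move=> i B mB; have -> : (fun t => (\mxcol_c E_c c (y_c c t)) i 0) =
      (fun t => E_c (tagnat.sig1 i) (y_c (tagnat.sig1 i) t) (tagnat.sig2 i) 0).
    by apply/funext => t; rewrite mxE.
  apply: (@sigma_vec_y_cluster (tagnat.sig1 i)).
  exact: post_mean_measurable.
- by move=> i; under eq_fun do rewrite NE; exact: (Nr i).1.
- move=> i A yA; under eq_integral do rewrite NE.
  by apply: (Nr i).2; rewrite -yE.
Qed.

Lemma FHSC_condexp_cluster c : is_condexp P (sigma_vec (y_c c)) (theta_c c)
  (fun t => E_c c (y_c c t)).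
Proof.
apply: (is_condexp_sub (@sigma_vec_y_cluster c)).
  exact: post_mean_measurable.
by have /is_condexp_mxcolP := FHSC_condexp; apply.
Qed.

End FHSC_posterior.

Theorem theoremA1 (R : realType)
  (* clusters *)
  (C : nat) (n : 'I_C -> nat) (hn : forall c, (0 < n c)%N)
  (* benchmarks *)
  (k : nat) (W : 'M[R]_(k, \sum_(c < C) n c)) (hW : row_free W) (p : 'cV[R]_k)
  (* posterior samples *)
  (Theta : set 'cV[R]_(\sum_(c < C) n c))
  (L : nat) (rho : nat -> R) (theta : nat -> 'cV[R]_(\sum_(c < C) n c))
  (hrho : forall l, (1 <= l <= L)%N -> 0 < rho l <= 1)
  (hTheta : forall l, (1 <= l <= L)%N ->
     Theta (invmx (A_SC n (rho l)) *m theta l))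
  (* FH-SC data and samples of its parameters *)
  (s q : 'I_C -> nat)
  (X : forall c, 'M[R]_(n c, s c)) (Z : forall c, 'M[R]_(n c, q c))
  (Dvar : forall c, 'rV[R]_(n c)) (hD : forall c j, 0 < Dvar c 0 j)
  (delta : nat -> forall c, 'cV[R]_(s c)) (G : nat -> forall c, 'M[R]_(q c))
  (hG : forall l c, (l < L)%N -> Z c *m G l c *m (Z c)^T \in unitmx)
  (l : nat) (hl : (1 <= l <= L)%N) :
  let A := A_SC n (rho l) in
  let thetaSC := invmx A *m theta l in
  let Theta' := Theta `&` benchmark_set W p in
  let obj := SC_objective (rho l) (theta l) in
  let dist := fun v => wnorm (invmx A) (thetaSC - v) in
  (* (i) *)
  [/\ convex_function [set: 'cV[R]_(\sum_(c < C) n c)] obj,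
      forall v, differentiable obj v,
      forall v, is_argmin Theta' obj v <-> is_argmin Theta' dist v &
      benchmark_set W p `<=` Theta -> forall v,
        (is_argmin (benchmark_set W p) obj v <-> is_argmin Theta' dist v) /\
        (is_argmin Theta' dist v <-> is_wproj (invmx A) Theta' thetaSC v)]
  /\
  (* (ii) *)
  (let thetaFHSC :=
     \mxcol_(c < C) (invmx (A_cluster (n c) (rho l)) *m submxcol (theta l) c) in
   let dist_FHSC := fun v => wnorm (invmx A) (thetaFHSC - v) in
   benchmark_set W p `<=` Theta -> forall v,
     is_argmin Theta' dist_FHSC v <-> v = benchmarked A W p thetaFHSC)
  /\
  (* (iii) *)
  (forall (d : measure_display) (T : measurableType d) (P : probability T R)
     (e : forall c, T -> 'cV[R]_(n c)) (u : forall c, T -> 'cV[R]_(q c)),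
   FHSC_errors P (fun c => diag_mx (Dvar c)) (G l.-1) e u ->
   let theta_c := fun c => FHSC_theta (rho l) (X c) (delta l.-1 c) (Z c) (u c) in
   let y_c := fun c => FHSC_y (rho l) (X c) (delta l.-1 c) (Z c) (u c) (e c) in
   let thetaFHSC := fun t => \mxcol_(c < C) theta_c c t in
   let y := fun t => \mxcol_(c < C) y_c c t in
   let E_c := fun c yc => post_mean_FHSC (rho l) (diag_mx (Dvar c)) (X c)
                (delta l.-1 c) (Z c) (G l.-1 c) yc in
   [/\ is_condexp P (sigma_vec y) thetaFHSC
         (fun t => \mxcol_(c < C) E_c c (y_c c t)),
       forall c, is_condexp P (sigma_vec (y_c c)) (theta_c c)
         (fun t => E_c c (y_c c t)),
       forall h, is_condexp P (sigma_vec y) thetaFHSC h ->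
         is_condexp P (sigma_vec y)
           (fun t => benchmarked A W p (thetaFHSC t))
           (fun t => h t + invmx A *m W^T *m invmx (W *m invmx A *m W^T)
                           *m (p - W *m h t)),
       (* cluster-level benchmarking constraints *)
       forall (w : forall c, 'rV[R]_(n c)) (pC : 'cV[R]_C),
         row_free (cluster_W w) -> forall c,
         forall h, is_condexp P (sigma_vec (y_c c)) (theta_c c) h ->
           is_condexp P (sigma_vec (y_c c))
             (fun t => submxcol (benchmarked A (cluster_W w) pC (thetaFHSC t)) c)
             (fun t => h t + ((a_den (rho l) (w c))^-1 *
                              (pC c 0 - (w c *m h t) 0 0))
                             *: a_num (rho l) (w c)) &
       (* one benchmarking constraint across all clusters *)
       forall (w : forall c, 'rV[R]_(n c)) (p1 : R),
         row_free (\mxrow_(c < C) w c) ->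
         forall h : forall c, T -> 'cV[R]_(n c),
         (forall c, is_condexp P (sigma_vec y) (theta_c c) (h c)) ->
         forall c,
         is_condexp P (sigma_vec y)
           (fun t => submxcol
              (benchmarked A (\mxrow_(c' < C) w c') p1%:M (thetaFHSC t)) c)
           (fun t => h c t +
              ((\sum_(c' < C) a_den (rho l) (w c'))^-1 *
               (p1 - \sum_(c' < C) (w c' *m h c' t) 0 0))
              *: a_num (rho l) (w c))]).
Proof.
move=> A thetaSC Theta' obj dist.
have rl := hrho l hl; have As := A_SC_sym (rho l) n.
have Ap : posdef A by exact: A_SC_pd.
(* Under this inclusion the constraint set is the whole affine subspace, where minimality amounts to
   orthogonality; on a proper subset it need not. *)
have ThetaE : benchmark_set W p `<=` Theta -> Theta' = benchmark_set W p.
  by move=> h; apply/seteqP; split => x; [case|move=> Wx; split => //; exact: h].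
have objdist F v : is_argmin F obj v <-> is_argmin F dist v.
  by apply: is_argmin_congr => x z; exact: SC_objective_le.
split; last split.
- split.
  + exact: SC_objective_convex.
  + exact: SC_objective_differentiable.
  + by move=> v; exact: objdist.
  + move=> /ThetaE -> v; split; first exact: objdist.
    exact: argmin_wprojP.
- move=> thetaFHSC distF /ThetaE -> v.
  have thE : thetaFHSC = thetaSC.
    by rewrite /thetaFHSC /thetaSC -{2}(submxcolK (theta l)) invmx_A_SC.
  exact: argmin_benchmarked.
move=> d T P e u HP theta_c y_c thetaFHSC y E_c.
have hGl c : Z c *m G l.-1 c *m (Z c)^T \in unitmx.
  (* Sample l uses the parameters of draw [l.-1], and 1 <= l <= L gives [l.-1 < L]. *)
  by apply: hG; case/andP: hl => l0 lL; rewrite prednK.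
have sy := sigma_algebra_sigma_vec y.
have my : sigma_vec y `<=` measurable.
  exact: (sigma_vec_y_measurable (X := X) (Z := Z) (rho := rho l) (delta := delta l.-1) HP).
split.
- exact: FHSC_condexp.
- by move=> c; exact: FHSC_condexp_cluster.
- move=> h; apply: (is_condexp_ext_affine sy my
    (f := fun x => benchmarked A W p x)
    (M := 1%:M - invmx A *m W^T *m invmx (W *m invmx A *m W^T) *m W)
    (b := invmx A *m W^T *m invmx (W *m invmx A *m W^T) *m p)) => x.
  by rewrite /benchmarked mulmxBl mul1mx mulmxBr mulmxA addrCA addrA.
- move=> w pC wf c h hc.
  have yy : sigma_vec (y_c c) `<=` sigma_vec y by exact: sigma_vec_y_cluster.
  (* With one constraint per cluster, block c of the benchmarked vector depends on [theta_c c]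
     alone, so conditioning on [y_c c] is enough. *)
  have -> : (fun t => submxcol (benchmarked A (cluster_W w) pC (thetaFHSC t)) c) =
     (fun t => theta_c c t + ((a_den (rho l) (w c))^-1 *
        (pC c 0 - (w c *m theta_c c t) 0 0)) *: a_num (rho l) (w c)).
    by apply/funext => t; rewrite cluster_benchmarkedE// mxcolK.
  apply: (is_condexp_ext_affine (sigma_algebra_sigma_vec _) (subset_trans yy my)
    (f := fun x => x + ((a_den (rho l) (w c))^-1 *
        (pC c 0 - (w c *m x) 0 0)) *: a_num (rho l) (w c))
    (M := 1%:M - (a_den (rho l) (w c))^-1 *: (a_num (rho l) (w c) *m w c))
    (b := ((a_den (rho l) (w c))^-1 * pC c 0) *: a_num (rho l) (w c))) => // x.
  rewrite mulmxBl mul1mx -scalemxAl -mulmxA.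
  have -> : a_num (rho l) (w c) *m (w c *m x) =
      (w c *m x) 0 0 *: a_num (rho l) (w c).
    by rewrite {1}[w c *m x]mx11_scalar mul_mx_scalar.
  by move: ((w c *m x) 0 0) => z; apply/colP => i; rewrite !mxE; ring.
- move=> w p1 wf h hc c.
  (* The single constraint involves every cluster, so the versions [h c] are stacked and conditioned
     on all of [y]. *)
  have hm : is_condexp P (sigma_vec y) thetaFHSC (fun t => \mxcol_c h c t).
    exact/is_condexp_mxcolP.
  have -> : (fun t => h c t + ((\sum_(c' < C) a_den (rho l) (w c'))^-1 *
               (p1 - \sum_(c' < C) (w c' *m h c' t) 0 0)) *: a_num (rho l) (w c)) =
      (fun t => submxcol (benchmarked A (\mxrow_(c' < C) w c') p1%:M
         (\mxcol_c h c t)) c).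
    apply/funext => t; rewrite single_benchmarkedE// mxcolK.
    by congr (_ + (_ * (_ - _)) *: _); apply: eq_bigr => c' _; rewrite mxcolK.
  pose K := invmx A *m (\mxrow_c w c)^T *m
    invmx (\mxrow_c w c *m invmx A *m (\mxrow_c w c)^T).
  apply: (is_condexp_ext_affine sy my
    (f := fun x => submxcol (benchmarked A (\mxrow_c w c) p1%:M x) c)
    (M := submxcol 1%:M c *m (1%:M - K *m \mxrow_c w c))
    (b := submxcol 1%:M c *m (K *m p1%:M))) => // x.
  rewrite [LHS]submxcol_linE -[X in _ = _ + X]mulmxA -[RHS]mulmxDr; congr (_ *m _).
  by rewrite /benchmarked -/K mulmxBl mul1mx mulmxBr mulmxA addrCA.
Qed.
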